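(* Let $1\leq p < \infty$ and $w \in A_p$. There are constants $C_1,C_2>0$ such that for every $a \in \mathbb{R}^n$ and $r>0$: if $1<p<\infty$, then $$\|Mf\|_{L^{p,w}(B(a,r))} \leq C_1\, w(B(a,r))^{\frac{1}{p}} \sup_{r < t < \infty} w(B(a,t))^{-\frac{1}{p}} \|f\|_{L^{p,w}(B(a,t))}\quad\text{for all } f \in L_{loc}^{p,w};$$ and $$\|Mf\|_{WL^{1,w}(B(a,r))} \le C_2\, w(B(a,r)) \sup_{r < t < \infty} w(B(a,t))^{-1} \|f\|_{L^{1,w}(B(a,t))}\quad\text{for all } f\in L_{loc}^{1,w}.$$
   Context: $M$ is the Hardy–Littlewood maximal operator $Mf(x)=\sup_{r>0}\frac{1}{|B(x,r)|}\int_{B(x,r)}|f(y)|\,dy$. $B(a,r)$ is the open ball, $w(E)=\int_E w$. For $1<p<\infty$, $A_p$ is the set of weights $w$ (nonnegative locally integrable, positive a.e.) with $\left(\frac{1}{|B|}\int_B w\right)\left(\frac{1}{|B|}\int_B w^{-\frac{1}{p-1}}\right)^{p-1}\le C$ for all balls $B$; $A_1$ is the set of weights with $\frac{1}{|B|}\int_B w\cdot\|w^{-1}\|_{L^\infty(B)}\le C$ for all balls $B$. For measurable $\Omega$: $\|f\|_{L^{p,w}(\Omega)}=\left(\int_\Omega |f|^p w\right)^{1/p}$ and $\|f\|_{WL^{p,w}(\Omega)}=\sup_{\gamma>0}\gamma\, w(\{x\in\Omega:|f(x)|>\gamma\})^{1/p}$. $L^{p,w}_{loc}$ is the set of measurable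 $f$ with $\|f\chi_B\|_{L^{p,w}}<\infty$ for every ball $B$.
   Formalization: The weak estimate is stated only for p = 1 (w in A_1), since it fails for w in A_p outside A_1, e.g. w = |x|^{1/2} in A_2 on the line; measurable is read as Borel measurable, which covers the general case after a change on a null set. *)

(* Defs.v *)
(* R^n is modelled as n.-tuple R with the product
   (= Borel) sigma-algebra provided by the library. *)
From HB Require Import structures.
From mathcomp Require Import all_boot all_order all_algebra.
From mathcomp Require Import all_classical all_reals all_analysis.
Set Implicit Arguments. Unset Strict Implicit. Unset Printing Implicit Defensive.
Import Order.TTheory GRing.Theory Num.Theory.
Local Open Scope classical_set_scope.
Local Open Scope ring_scope.

Section Defs.
Context {R : realType} {n : nat}.
Local Notation V := (n.-tuple R).

Definition edist (x y : V) : R :=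
  Num.sqrt (\sum_(i < n) (tnth x i - tnth y i) ^+ 2).

Definition oball (a : V) (r : R) : set V := [set x | edist a x < r].

(* mu is Lebesgue measure on R^n: the measure on the Borel sets giving
   half-open boxes their volume (this determines it uniquely). *)
Definition is_lebesgue (mu : {measure set V -> \bar R}) : Prop :=
  forall a b : V, (forall i, tnth a i <= tnth b i) ->
    mu [set x | forall i, tnth a i <= tnth x i < tnth b i] =
    (\prod_(i < n) (tnth b i - tnth a i))%:E.

Variable mu : {measure set V -> \bar R}.

Definition is_weight (w : V -> R) : Prop :=
  [/\ measurable_fun setT w,
      (forall x, 0 <= w x),
      (forall a r, (mu.-integrable (oball a r) (fun x => (w x)%:E))) &
      (\forall x \ae mu, 0 < w x)].

Definition wmeas (w : V -> R) (E : set V) : \bar R :=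
  (\int[mu]_(x in E) (w x)%:E)%E.

Definition avg (B : set V) (g : V -> \bar R) : \bar R :=
  (((fine (mu B))^-1)%:E * \int[mu]_(x in B) g x)%E.

Definition ess_sup_on (B : set V) (g : V -> \bar R) : \bar R :=
  ereal_inf [set y | \forall x \ae mu, B x -> (g x <= y)%E].

Definition Ap (p : R) (w : V -> R) : Prop :=
  is_weight w /\ exists C : R, forall (a : V) (r : R), 0 < r ->
    (avg (oball a r) (fun x => (w x)%:E) *
     poweR (avg (oball a r) (fun x => (w x `^ (- (p - 1)^-1))%:E)) (p - 1)
     <= C%:E)%E.

Definition A1 (w : V -> R) : Prop :=
  is_weight w /\ exists C : R, forall (a : V) (r : R), 0 < r ->
    (avg (oball a r) (fun x => (w x)%:E) *
     ess_sup_on (oball a r) (fun x => ((w x)^-1)%:E) <= C%:E)%E.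

Definition maxf (f : V -> R) (x : V) : \bar R :=
  ereal_sup [set avg (oball x r) (fun y => (`|f y|)%:E) | r in `]0, +oo[].

Definition Lpw_norm (p : R) (w : V -> R) (Om : set V) (g : V -> \bar R)
  : \bar R :=
  poweR (\int[mu]_(x in Om) (poweR `|g x| p * (w x)%:E))%E p^-1.

Definition WLpw_norm (p : R) (w : V -> R) (Om : set V) (g : V -> \bar R)
  : \bar R :=
  ereal_sup [set (gam%:E * poweR (wmeas w [set x | Om x /\ (gam%:E < `|g x|)%E]) p^-1)%E
            | gam in `]0, +oo[].

Definition Lpw_loc (p : R) (w : V -> R) (f : V -> R) : Prop :=
  measurable_fun setT f /\
  forall (a : V) (r : R),
    (Lpw_norm p w (oball a r) (fun x => (f x)%:E) < +oo)%E.

End Defs.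

(* Main.v *)
Require Import Defs.
From HB Require Import structures.
From mathcomp Require Import all_boot all_order all_algebra.
From mathcomp Require Import all_classical all_reals all_analysis.
From mathcomp Require Import measurable_realfun ring lra.
Import Order.TTheory GRing.Theory Num.Theory.
Local Open Scope classical_set_scope.
Local Open Scope ring_scope.
Set Implicit Arguments.
Unset Strict Implicit.
Unset Printing Implicit Defensive.

(* Write B = B(a, r). For x in B the averages of |f| over B(x, s) with s > r are
   bounded by averages over B(a, 2s), which the A_p condition bounds by the
   supremum on the right-hand side. The averages with s <= r only see f on
   B(a, 3r), so that Muckenhoupt's theorem applies to that truncation and
   doubling of w brings back w(B).
   Muckenhoupt's theorem is proved by Lerner's argument: with
   sg = w^(-1/(p-1)) one has, for maximal functions over a finite family of
   balls,
     M f <= C (M_w ((M_sg (f/sg))^(p-1) / w))^(1/(p-1)),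
   and the weighted maximal functions M_w and M_sg are bounded on
   L^(p/(p-1))(w) and L^p(sg) because w and sg are doubling. No reverse Hoelder
   inequality is needed. Balls with rational centres and radii and monotone
   convergence lead back to M itself. *)

(* all_analysis also defines an [edist], which shadows the one of Defs. *)
Local Notation edist := Defs.edist.

(** Finite families are what makes the absorption argument legitimate: their maximal functions are
    bounded and vanish off a set of finite weight, so a term containing M on the right can be moved
    to the left. They also turn the layer-cake integral into a finite summation by parts. All
    constants are fixed before the family, hence survive the limit. The cases p = 1 and p > 1 meet
    in the predicate [testing]. Doubling and the averages over large balls are derived from it
    alone, and for p = 1 it also converts a Lebesgue average into a weighted one in the weak-type
    estimate. The supremum on the right-hand side enters only through a real number [phi] above it.
    Measurability of [maxf mu f] is never established. Its powers are compared with measurable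
    majorants and its level sets are covered by unions of balls, because integrals of nonnegative
    functions are monotone in any case. *)

Ltac measurability := repeat first
  [ assumption | exact: measurable_cst | exact: measurable_id
  | apply: measurable_funM | apply: measurable_funD | apply: measurable_funB
  | apply: measurable_maxr
  | apply: (measurableT_comp (measurable_powR _)) ].

(** * Euclidean balls and Lebesgue measure *)

Section Geometry.
Context {R : realType} {n : nat}.
Local Notation V := (n.-tuple R).
Implicit Types (x y z a b : V) (r : R).

Lemma edist_ge0 x y : 0 <= edist x y.
Proof. exact: sqrtr_ge0. Qed.

Lemma edistC x y : edist x y = edist y x.
Proof. by rewrite /edist; congr Num.sqrt; apply: eq_bigr => i _; ring. Qed.

Lemma edistxx x : edist x x = 0.
Proof.
rewrite /edist big1 ?sqrtr0// => i _.
by rewrite subrr expr0n.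
Qed.

Lemma sqr_edist x y : edist x y ^+ 2 = \sum_(i < n) (tnth x i - tnth y i) ^+ 2.
Proof. by rewrite sqr_sqrtr// sumr_ge0// => i _; exact: sqr_ge0. Qed.

Lemma coord_le_edist x y (i : 'I_n) : `|tnth x i - tnth y i| <= edist x y.
Proof.
rewrite -(ler_pXn2r (n := 2))// ?nnegrE ?edist_ge0// sqr_edist real_normK ?num_real//.
by rewrite (bigD1 i)//= lerDl sumr_ge0// => j _; exact: sqr_ge0.
Qed.

Lemma edist_eq0 x y : edist x y = 0 -> x = y.
Proof.
move=> d0; apply: eq_from_tnth => i; apply/eqP.
by rewrite -subr_eq0 -normr_le0 (le_trans (coord_le_edist _ _ _))// d0.
Qed.

(* With A, B the two lengths, (u + v)^2 <= (1 + B/A) u^2 + (1 + A/B) v^2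
   holds coordinatewise and sums up to (A + B)^2. *)
Lemma edist_triangle y x z : edist x z <= edist x y + edist y z.
Proof.
have [A0|A0] := eqVneq (edist x y) 0; first by rewrite A0 add0r (edist_eq0 A0).
have [B0|B0] := eqVneq (edist y z) 0; first by rewrite B0 addr0 (edist_eq0 B0).
set A := edist x y in A0 *; set B := edist y z in B0 *.
have Ap : 0 < A by rewrite lt_def A0 edist_ge0.
have Bp : 0 < B by rewrite lt_def B0 edist_ge0.
rewrite -(ler_pXn2r (n := 2))// ?nnegrE ?edist_ge0// ?addr_ge0 ?edist_ge0//.
have -> : (A + B) ^+ 2 = (1 + B / A) * A ^+ 2 + (1 + A / B) * B ^+ 2.
  by field; rewrite A0 B0.
rewrite !sqr_edist !mulr_sumr -big_split/=; apply: ler_sum => i _.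
set u := tnth x i - tnth y i; set v := tnth y i - tnth z i.
have -> : tnth x i - tnth z i = u + v by rewrite /u /v; ring.
rewrite -subr_ge0.
have -> : (1 + B / A) * u ^+ 2 + (1 + A / B) * v ^+ 2 - (u + v) ^+ 2 =
    (B * u - A * v) ^+ 2 / (A * B) by field; rewrite A0 B0.
by rewrite divr_ge0 ?sqr_ge0// mulr_ge0// ltW.
Qed.

(** The factor [n] stands in for its square root, so that after squaring only n <= n^2 is used. *)
Lemma edist_le_bound x y e : 0 <= e ->
  (forall i, `|tnth x i - tnth y i| <= e) -> edist x y <= n%:R * e.
Proof.
have [n0 _ _|n0] := posnP n.
  rewrite /edist big1 ?sqrtr0 ?n0 ?mul0r// => i.
  by have := ltn_ord i; rewrite {2}n0.
move=> e0 h; rewrite -(ler_pXn2r (n := 2))// ?nnegrE ?edist_ge0 ?mulr_ge0//.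
rewrite sqr_edist (@le_trans _ _ (\sum_(i < n) e ^+ 2))//.
  by apply: ler_sum => i _; rewrite -real_normK ?num_real// ler_pXn2r ?nnegrE.
rewrite sumr_const card_ord -(mulr_natl (e ^+ 2)) exprMn ler_wpM2r ?sqr_ge0//.
by rewrite expr2 -natrM ler_nat leq_pmulr.
Qed.

Lemma oball_center a r : 0 < r -> oball a r a.
Proof. by rewrite /oball/= edistxx. Qed.

Lemma sub_oball a b r s : edist b a + r <= s -> oball a r `<=` oball b s.
Proof.
move=> h x; rewrite /oball/= => ax.
by rewrite (le_lt_trans (edist_triangle a _ _))// (lt_le_trans _ h)// ltrD2l.
Qed.

Lemma measurable_coord (i : 'I_n) :
  measurable_fun [set: V] (fun x => tnth x i : R).
Proof. exact: measurable_tnth. Qed.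

Lemma measurable_oball a r : measurable (oball a r).
Proof.
have [r0|r0] := leP r 0.
  rewrite (_ : oball a r = set0)//; apply/seteqP; split => x //=.
  by rewrite /oball/= ltNge (le_trans r0 (edist_ge0 _ _)).
have mf : measurable_fun [set: V]
    (fun x => \sum_(i < n) (tnth a i - tnth x i) ^+ 2).
  apply: measurable_sum => i; apply: measurable_funX.
  by apply: measurable_funB => //; exact: measurable_coord.
rewrite (_ : oball a r = setT `&` (fun x => \sum_(i < n)
    (tnth a i - tnth x i) ^+ 2) @^-1` `]-oo, r ^+ 2[); first exact: mf.
apply/seteqP; split => x /=.
  rewrite /oball/= in_itv/= -sqr_edist => ?; split=> //.
  by rewrite ltr_pXn2r ?nnegrE ?edist_ge0// ltW.
rewrite /oball/= in_itv/= -sqr_edist => -[_].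
by rewrite ltr_pXn2r ?nnegrE ?edist_ge0// ltW.
Qed.

Definition hbox a b : set V := [set x | forall i, tnth a i <= tnth x i < tnth b i].

Lemma measurable_hbox a b : measurable (hbox a b).
Proof.
have -> : hbox a b = \bigcap_(i in [set: 'I_n])
    ((fun x : V => tnth x i) @^-1` `[tnth a i, tnth b i[).
  apply/seteqP; split => x /=.
    by move=> h i _ /=; rewrite in_itv/=; exact: h.
  by move=> h i; have := h i Logic.I; rewrite /= in_itv.
apply: fin_bigcap_measurable; first exact: finite_finset.
move=> i _; rewrite -[X in measurable X]setTI.
by apply: measurable_coord => //; exact: measurable_itv.
Qed.

Definition cube a (h : R) : set V :=
  hbox [tuple tnth a i - h | i < n] [tuple tnth a i + h | i < n].

Variable mu : {measure set V -> \bar R}.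
Hypotheses (n_gt0 : (0 < n)%N) (mu_leb : is_lebesgue mu).

Lemma mu_cube a h : 0 <= h -> mu (cube a h) = ((2 * h) ^+ n)%:E.
Proof.
move=> h0; rewrite /cube/hbox mu_leb; last by move=> i; rewrite !tnth_mktuple; lra.
rewrite (eq_bigr (fun=> 2 * h)) ?prodr_const ?card_ord// => i _.
by rewrite !tnth_mktuple; ring.
Qed.

Lemma mu_oball_le a r : 0 < r -> (mu (oball a r) <= ((2 * r) ^+ n)%:E)%E.
Proof.
move=> r0; rewrite -(mu_cube a) ?(ltW r0)//.
apply: le_measure; rewrite ?inE; [exact: measurable_oball|exact: measurable_hbox|].
move=> x; rewrite /oball /cube /hbox/= => ax i; rewrite !tnth_mktuple.
have := le_lt_trans (coord_le_edist a x i) ax.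
by rewrite ltr_norml => /andP[? ?]; apply/andP; split; lra.
Qed.

Lemma mu_oball_ge a r : 0 < r -> (((r / n%:R) ^+ n)%:E <= mu (oball a r))%E.
Proof.
(* The inscribed cube has side r/n. Its points are at distance at most n h = r/2 from [a]; the
   halving gives the strict inequality of an open ball. *)
move=> r0; set h := r / (2 * n%:R).
have nr0 : 0 < n%:R :> R by rewrite ltr0n.
have h0 : 0 < h by rewrite divr_gt0// mulr_gt0.
have -> : r / n%:R = 2 * h by rewrite /h; field; rewrite gt_eqF.
rewrite -(mu_cube a) ?(ltW h0)//.
apply: le_measure; rewrite ?inE; [exact: measurable_hbox|exact: measurable_oball|].
move=> x; rewrite /oball /cube /hbox/= => ax.
apply: (@le_lt_trans _ _ (n%:R * h)).
  apply: edist_le_bound; first exact: ltW.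
  move=> i; have := ax i; rewrite !tnth_mktuple => /andP[? ?].
  by rewrite ler_norml; apply/andP; split; lra.
have -> : n%:R * h = r / 2 by rewrite /h; field; rewrite gt_eqF.
lra.
Qed.

Definition vol a r : R := fine (mu (oball a r)).

Lemma volE a r : 0 < r -> mu (oball a r) = (vol a r)%:E.
Proof.
move=> r0; rewrite /vol fineK// ge0_fin_numE//.
by rewrite (le_lt_trans (mu_oball_le a r0))// ltry.
Qed.

Lemma vol_gt0 a r : 0 < r -> 0 < vol a r.
Proof.
move=> r0; rewrite -lte_fin -volE// (lt_le_trans _ (mu_oball_ge a r0))//.
by rewrite lte_fin exprn_gt0// divr_gt0// ltr0n.
Qed.

(** The centres are unrelated: the ball of radius k r lies in a cube of side 2 k r, the ball of
    radius r contains one of side r/n, and the constant is the ratio of the sides to the power n. *)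
Lemma vol_dilation a b r k : 0 < r -> 0 < k ->
  vol b (k * r) <= (2 * n%:R * k) ^+ n * vol a r.
Proof.
move=> r0 k0; have nr0 : 0 < n%:R :> R by rewrite ltr0n.
apply: (@le_trans _ _ ((2 * (k * r)) ^+ n)).
  by rewrite -lee_fin -volE ?mulr_gt0// mu_oball_le// mulr_gt0.
have -> : 2 * (k * r) = (2 * n%:R * k) * (r / n%:R) by field; rewrite gt_eqF.
rewrite [X in X <= _]exprMn ler_wpM2l//.
  by rewrite exprn_ge0// !mulr_ge0// ltW.
by rewrite -lee_fin -volE// mu_oball_ge.
Qed.

End Geometry.

(** * Maximal functions over finite families of balls *)

Section Integrals.
Context {d} {T : measurableType d} {R : realType}.
Variable mu : {measure set T -> \bar R}.
Implicit Types (D : set T) (f g : T -> R).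

(* The integral of a nonnegative function is a supremum over simple functions
   below it, so that it is monotone without any measurability assumption. *)
Lemma le_integral_nonneg D (f g : T -> \bar R) :
  (forall x, D x -> (0 <= f x)%E) -> (forall x, D x -> (f x <= g x)%E) ->
  (\int[mu]_(x in D) f x <= \int[mu]_(x in D) g x)%E.
Proof.
move=> f0 fg; rewrite !ge0_integralE//; last first.
  by move=> x Dx; exact: le_trans (f0 x Dx) (fg x Dx).
apply: le_ereal_sup => _ [h /= hf <-]; exists h => //= x.
apply: le_trans (hf x) _; rewrite !patchE; case: ifPn => // /set_mem Dx.
exact: fg.
Qed.

Lemma measurable_EFin D f : measurable_fun setT f ->
  measurable_fun D (fun x => (f x)%:E).
Proof.
by move=> mf; apply/measurable_EFinP; exact: measurable_funTS.
Qed.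

Lemma integralZ_EFin D f (k : R) : measurable D -> measurable_fun setT f ->
  (forall x, D x -> 0 <= f x) -> 0 <= k ->
  (\int[mu]_(x in D) (k * f x)%:E = k%:E * \int[mu]_(x in D) (f x)%:E)%E.
Proof.
move=> mD mf f0 k0; under eq_integral do rewrite EFinM.
rewrite ge0_integralZl_EFin//; last exact: measurable_EFin.
Qed.

Lemma integralD_EFin D f g : measurable D ->
  measurable_fun setT f -> measurable_fun setT g ->
  (forall x, D x -> 0 <= f x) -> (forall x, D x -> 0 <= g x) ->
  (\int[mu]_(x in D) (f x + g x)%:E =
   \int[mu]_(x in D) (f x)%:E + \int[mu]_(x in D) (g x)%:E)%E.
Proof.
move=> mD mf mg f0 g0; under eq_integral do rewrite EFinD.
by rewrite ge0_integralD//; exact: measurable_EFin.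
Qed.

Lemma integral_support D E (f : T -> \bar R) : E `<=` D ->
  (forall x, D x -> ~ E x -> f x = 0%E) ->
  (\int[mu]_(x in D) f x = \int[mu]_(x in E) f x)%E.
Proof.
move=> ED f0; rewrite integral_mkcond [RHS]integral_mkcond.
apply: eq_integral => x _; rewrite !patchE.
case: ifPn => [/set_mem Dx|/negP Dx]; case: ifPn => [/set_mem Ex|/negP Ex] //.
- by apply: f0 => // Ex'; apply: Ex; exact/mem_set.
- by exfalso; apply: Dx; apply/mem_set; exact: ED.
Qed.

Lemma integralU_le D E f : measurable D -> measurable E ->
  measurable_fun setT f -> (forall x, 0 <= f x) ->
  (\int[mu]_(x in D `|` E) (f x)%:E <=
   \int[mu]_(x in D) (f x)%:E + \int[mu]_(x in E) (f x)%:E)%E.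
Proof.
move=> mD mE mf f0.
have -> : D `|` E = D `|` (E `\` D).
  by rewrite setUDr setDv setD0.
rewrite ge0_integral_setU//=; first last.
- by rewrite disj_set2E setDE setICA setICr setI0.
- by move=> x _; rewrite lee_fin.
- exact: measurable_EFin.
- exact: measurableD.
rewrite leeD2l// ge0_subset_integral//.
- exact: measurableD.
- exact: measurable_EFin.
- by move=> x _; rewrite lee_fin.
Qed.

End Integrals.

(** Young's inequality for v and t^(q-1) with exponents q and q/(q-1). This is the discrete form of
    d(s^q) = q/(q-1) s d(s^(q-1)): an increment of the q-th power is traded for a factor [v], to
    which a weak-type bound applies. *)
Lemma levelset_increment {R : realType} (q v t : R) : 1 < q -> 0 <= v -> 0 <= t ->
  v `^ q - t `^ q <= q / (q - 1) * (v * (v `^ (q - 1) - t `^ (q - 1))).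
Proof.
move=> q1 v0 t0; have q0 : 0 < q by rewrite (lt_trans _ q1).
have qq : 0 < q - 1 by rewrite subr_gt0.
have := @conjugate_powR _ v (t `^ (q - 1)) q (q / (q - 1)) v0 (powR_ge0 _ _) q0.
rewrite divr_gt0// => /(_ isT); rewrite -powRrM.
have -> : (q - 1) * (q / (q - 1)) = q by field; rewrite gt_eqF.
have -> : q^-1 + (q / (q - 1))^-1 = 1 by field; rewrite !gt_eqF.
move=> /(_ erefl) h.
rewrite mulrBr mulrBr mulr_powRB1//.
have : q / (q - 1) * (v * t `^ (q - 1)) <=
  q / (q - 1) * (v `^ q / q + t `^ q / (q / (q - 1))).
  by rewrite ler_wpM2l// divr_ge0// ltW.
have -> : q / (q - 1) * (v `^ q / q + t `^ q / (q / (q - 1))) =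
  q / (q - 1) * v `^ q - v `^ q + t `^ q by field; rewrite !gt_eqF.
lra.
Qed.

Section FiniteMaximal.
Context {R : realType} {n : nat}.
Local Notation V := (n.-tuple R).
Variable mu : {measure set V -> \bar R}.
Implicit Types (s : seq (V * R)) (av : V * R -> R) (x : V).

Definition uballs s : set V := \big[setU/set0]_(b <- s) oball b.1 b.2.

Lemma uballs_cons b s : uballs (b :: s) = oball b.1 b.2 `|` uballs s.
Proof. by rewrite /uballs big_cons. Qed.

Lemma uballsP s x : uballs s x <-> exists2 b, b \in s & oball b.1 b.2 x.
Proof.
elim: s => [|b s IH]; first by rewrite /uballs big_nil; split=> // -[].
rewrite uballs_cons; split.
  case=> [bx|/IH[c cs cx]]; first by exists b; rewrite ?mem_head.
  by exists c; rewrite // inE cs orbT.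
case=> c; rewrite inE => /orP[/eqP-> ?|cs cx]; first by left.
by right; apply/IH; exists c.
Qed.

Lemma measurable_uballs s : measurable (uballs s).
Proof. by apply: bigsetU_measurable => b _; exact: measurable_oball. Qed.

(** An uncentred maximal function in which [av] is any assignment of numbers to balls, so that
    Lebesgue averages and averages against a weight are treated at once. *)
Definition maxs s av x : R :=
  \big[Num.max/0]_(b <- s) (av b * \1_(oball b.1 b.2) x).

Lemma maxs_cons b s av x :
  maxs (b :: s) av x = Num.max (av b * \1_(oball b.1 b.2) x) (maxs s av x).
Proof. by rewrite /maxs big_cons. Qed.

Lemma maxs_ge0 s av x : 0 <= maxs s av x.
Proof.
elim: s => [|b s IH]; first by rewrite /maxs big_nil.
by rewrite maxs_cons le_max IH orbT.
Qed.

Lemma le_maxs s av b x : b \in s -> oball b.1 b.2 x -> av b <= maxs s av x.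
Proof.
elim: s => // c s IH; rewrite inE maxs_cons le_max => /orP[/eqP <- bx|bs bx].
  by rewrite indicE mem_set// mulr1 lexx.
by rewrite IH ?orbT.
Qed.

Lemma maxs_le s av x K : 0 <= K ->
  (forall b, b \in s -> oball b.1 b.2 x -> av b <= K) -> maxs s av x <= K.
Proof.
move=> K0; elim: s => [|c s IH] h; first by rewrite /maxs big_nil.
rewrite maxs_cons ge_max IH ?andbT; last by move=> b bs; apply: h; rewrite inE bs orbT.
rewrite indicE; have [/set_mem cx|_] := boolP (x \in _); last by rewrite mulr0.
by rewrite mulr1 h// mem_head.
Qed.

Lemma maxs_notin s av x : ~ uballs s x -> maxs s av x = 0.
Proof.
move=> h; apply/eqP; rewrite eq_le maxs_ge0 andbT maxs_le// => b bs bx.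
by exfalso; apply: h; apply/uballsP; exists b.
Qed.

Lemma eq_mem_maxs s s' av x : s =i s' -> maxs s av x = maxs s' av x.
Proof.
move=> ss; apply/eqP; rewrite eq_le !maxs_le ?maxs_ge0// => b bs bx.
- by apply: le_maxs; rewrite // ss.
- by apply: le_maxs; rewrite // -ss.
Qed.

Lemma measurable_maxs s av : measurable_fun setT (maxs s av).
Proof.
elim: s => [|b s IH].
  by rewrite (_ : maxs [::] av = cst 0)//; apply/funext => x; rewrite /maxs big_nil.
rewrite (_ : maxs _ av = fun x =>
  Num.max (av b * \1_(oball b.1 b.2) x) (maxs s av x)); last first.
  by apply/funext => x; rewrite maxs_cons.
apply: measurable_maxr => //; apply: measurable_funM => //.
by apply: measurable_indic; exact: measurable_oball.
Qed.

Lemma largest_ball s : s != [::] ->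
  exists2 b, b \in s & forall c, c \in s -> c.2 <= b.2.
Proof.
elim: s => // c s IH _; have [->|s0] := eqVneq s [::].
  by exists c; rewrite ?mem_head// => b; rewrite inE => /eqP->.
have [b bs hb] := IH s0; have [cb|bc] := leP c.2 b.2.
  exists b; first by rewrite inE bs orbT.
  by move=> e; rewrite inE => /orP[/eqP->//|]; exact: hb.
exists c; first by rewrite mem_head.
move=> e; rewrite inE => /orP[/eqP->//|es].
by rewrite (le_trans (hb _ es))// ltW.
Qed.

Variables (W : V -> R) (D : R).
Hypotheses (mW : measurable_fun setT W) (W0 : forall x, 0 <= W x).
Hypothesis Wfin : forall a r, (0 < r)%R -> (wmeas mu W (oball a r) < +oo)%E.
Hypothesis D0 : 0 <= D.
Hypothesis WD : forall a r, 0 < r ->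
  (wmeas mu W (oball a (3 * r)) <= D%:E * wmeas mu W (oball a r))%E.

Lemma wmeas_ge0 E : (0 <= wmeas mu W E)%E.
Proof. by apply: integral_ge0 => x _; rewrite lee_fin. Qed.

Lemma le_wmeas E F : measurable E -> measurable F -> E `<=` F ->
  (wmeas mu W E <= wmeas mu W F)%E.
Proof.
move=> mE mF EF; apply: ge0_subset_integral => //; first exact: measurable_EFin.
by move=> x _; rewrite lee_fin.
Qed.

Lemma wmeas_uballs_fin s : (forall b, b \in s -> 0 < b.2) ->
  (wmeas mu W (uballs s) < +oo)%E.
Proof.
elim: s => [_|b s IH h]; first by rewrite /uballs big_nil /wmeas integral_set0.
rewrite uballs_cons (le_lt_trans (integralU_le _ _ _ _ _))//.
- exact: measurable_oball.
- exact: measurable_uballs.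
- rewrite lte_add_pinfty ?Wfin ?IH ?h ?mem_head// => c cs.
  by apply: h; rewrite inE cs orbT.
Qed.

Variable g : V -> R.
Hypotheses (mg : measurable_fun setT g) (g0 : forall x, 0 <= g x).

Let mgW : measurable_fun setT (fun x => g x * W x).
Proof. exact: measurable_funM. Qed.

Let gW0 x : 0 <= g x * W x. Proof. exact: mulr_ge0. Qed.

(* Greedy Vitali selection: the balls meeting a ball of largest radius lie in
   its dilation by 3. *)
Lemma weak_type_finite s lam : 0 <= lam -> (forall b, b \in s -> 0 < b.2) ->
  (forall b, b \in s -> (lam%:E * wmeas mu W (oball b.1 b.2) <=
    \int[mu]_(x in oball b.1 b.2) (g x * W x)%:E)%E) ->
  (lam%:E * wmeas mu W (uballs s) <=
    D%:E * \int[mu]_(x in uballs s) (g x * W x)%:E)%E.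
Proof.
move=> lam0; have [k] := ubnP (size s); elim: k s => // k IH s.
have [->|s0] := eqVneq s [::].
  by rewrite /uballs big_nil /wmeas !integral_set0 !mule0.
rewrite ltnS => sk rs hs; have [b bs maxb] := largest_ball s0.
pose disj (c : V * R) := `[< oball c.1 c.2 `&` oball b.1 b.2 = set0 >].
pose s' := [seq c <- s | disj c].
have s's c : c \in s' -> c \in s by rewrite mem_filter => /andP[].
have sz : (size s' < k)%N.
  apply: leq_trans sk; rewrite size_filter ltn_neqAle count_size andbT.
  rewrite -all_count; apply/negP => /allP/(_ _ bs)/asboolP; apply/eqP/set0P.
  by exists b.1; split; apply: oball_center; exact: rs.
have IHs := IH s' sz (fun c cs => rs c (s's c cs)) (fun c cs => hs c (s's c cs)).
have cover : uballs s `<=` oball b.1 (3 * b.2) `|` uballs s'.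
  move=> x /uballsP[c cs cx]; have [dc|ndc] := boolP (disj c).
    by right; apply/uballsP; exists c; rewrite // mem_filter dc.
  left; move/asboolPn/eqP/set0P : ndc => [y [cy bY]].
  rewrite /oball/= in cx cy bY *.
  have := @edist_triangle _ _ y b.1 x; have := @edist_triangle _ _ c.1 y x.
  rewrite (edistC y c.1); have := maxb _ cs; lra.
(* Disjointness lets the two integrals of g W add up, so that the constant stays [D] whatever the
   number of balls. *)
have disjU : oball b.1 b.2 `&` uballs s' = set0.
  rewrite -subset0 => x [bx /uballsP[c]]; rewrite mem_filter => /andP[/asboolP h _] cx.
  by rewrite -h.
apply: (@le_trans _ _ (lam%:E *
    (wmeas mu W (oball b.1 (3 * b.2)) + wmeas mu W (uballs s')))%E).
  apply: lee_wpmul2l; first by rewrite lee_fin.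
  apply: le_trans (integralU_le mu _ _ mW W0); last 2 first.
  - exact: measurable_oball.
  - exact: measurable_uballs.
  apply: le_wmeas => //; first exact: measurable_uballs.
  by apply: measurableU; [exact: measurable_oball|exact: measurable_uballs].
rewrite ge0_muleDr ?wmeas_ge0//.
apply: (@le_trans _ _ (D%:E * \int[mu]_(x in oball b.1 b.2 `|` uballs s')
    (g x * W x)%:E)%E); last first.
  apply: lee_wpmul2l; first by rewrite lee_fin.
  apply: ge0_subset_integral.
  - by apply: measurableU; [exact: measurable_oball|exact: measurable_uballs].
  - exact: measurable_uballs.
  - exact: measurable_EFin.
  - by move=> x _; rewrite lee_fin.
  - move=> x [bx|/uballsP[c cs cx]]; apply/uballsP; first by exists b.
    by exists c => //; exact: s's.
rewrite ge0_integral_setU//; first last.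
- by rewrite disj_set2E disjU.
- by move=> x _; rewrite lee_fin.
- exact: measurable_EFin.
- exact: measurable_uballs.
- exact: measurable_oball.
rewrite [in leRHS]ge0_muleDr; try by apply: integral_ge0 => x _; rewrite lee_fin.
apply: leeD => //.
apply: (@le_trans _ _ (lam%:E * (D%:E * wmeas mu W (oball b.1 b.2)))%E).
  by apply: lee_wpmul2l; rewrite ?lee_fin// WD// rs.
rewrite muleCA; apply: lee_wpmul2l; first by rewrite lee_fin.
exact: hs.
Qed.

Section StrongType.
Variables (q : R) (av : V * R -> R).
Hypotheses (q1 : 1 < q) (av0 : forall b, 0 <= av b).

Let q0 : 0 < q. Proof. by rewrite (lt_trans _ q1). Qed.
Let qq : 0 < q - 1. Proof. by rewrite subr_gt0. Qed.
Let p0 : 0 <= q / (q - 1). Proof. by rewrite divr_ge0// ltW. Qed.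

(** The bound of [av b] by the W-average of [g], written without division because W(B) may vanish at
    this stage. *)
Definition avg_family s := forall b, b \in s -> 0 < b.2 /\
  ((av b)%:E * wmeas mu W (oball b.1 b.2) <=
    \int[mu]_(x in oball b.1 b.2) (g x * W x)%:E)%E.

Let mpow s c : measurable_fun setT (fun x => maxs s av x `^ c).
Proof.
by apply: (measurableT_comp (measurable_powR _)); exact: measurable_maxs.
Qed.

(* Summation by parts over the levels [av b], taken in decreasing order by
   peeling off the ball with the smallest one. *)
Lemma maxs_abel s t : 0 <= t -> (forall b, b \in s -> t <= av b) ->
  sorted (relpre av <=%R) s -> avg_family s ->
  (\int[mu]_(x in uballs s) ((maxs s av x `^ q - t `^ q) * W x)%:E <=
   (q / (q - 1) * D)%:E * \int[mu]_(x in uballs s)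
     ((maxs s av x `^ (q - 1) - t `^ (q - 1)) * (g x * W x))%:E)%E.
Proof.
elim: s t => [|b s IH] t t0 ts sorts hs.
  by rewrite /uballs big_nil !integral_set0 mule0.
set v := av b; have v0 : 0 <= v := av0 b.
have vs c : c \in s -> v <= av c.
  have tr : transitive (relpre av <=%R) by move=> x y z /=; exact: le_trans.
  exact: (allP (order_path_min tr sorts)).
have {IH}IH := IH v v0 vs (path_sorted sorts)
  (fun c cs => hs c (mem_behead (s := b :: s) cs)).
have tv : t <= v by apply: ts; rewrite mem_head.
set U := uballs (b :: s); have mU : measurable U by exact: measurable_uballs.
have UsU : uballs s `<=` U by rewrite /U uballs_cons; exact: subsetUr.
have Mv x : U x -> v <= maxs (b :: s) av x.
  move=> /uballsP[c cs cx]; apply: le_trans (le_maxs av cs cx).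
  by move: cs; rewrite inE => /orP[/eqP->//|]; exact: vs.
have Ms x : uballs s x -> maxs (b :: s) av x = maxs s av x.
  move=> /uballsP[c cs cx]; rewrite maxs_cons; apply/max_idPr.
  apply: (@le_trans _ _ v); last exact: le_trans (vs _ cs) (le_maxs av cs cx).
  by rewrite indicE; case: (_ \in _); rewrite ?mulr1 ?mulr0.
have Mn x : U x -> ~ uballs s x -> maxs (b :: s) av x = v.
  rewrite /U uballs_cons => -[bx|//] nx.
  by rewrite maxs_cons (maxs_notin _ nx) indicE mem_set// mulr1; exact/max_idPl.
have powD c : 0 < c -> forall x, U x -> 0 <= maxs (b :: s) av x `^ c - v `^ c.
  move=> c0 x Ux; rewrite subr_ge0 ge0_ler_powR ?nnegrE ?maxs_ge0 ?(ltW c0)//.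
  exact: Mv.
have vtD c : 0 < c -> 0 <= v `^ c - t `^ c.
  by move=> c0; rewrite subr_ge0 ge0_ler_powR ?nnegrE ?(ltW c0).
(* On [uballs s] the ball [b] does not change the maximum; on the rest of [U] the maximum is exactly
   [v]. Subtracting v^c thus leaves the integral of the induction hypothesis at level [v], plus a
   constant increment over [U]. Used for (q, W) and for (q - 1, g W). *)
have splitE c (h : V -> R) : 0 < c -> measurable_fun setT h -> (forall x, 0 <= h x) ->
  (\int[mu]_(x in U) ((maxs (b :: s) av x `^ c - t `^ c) * h x)%:E =
   \int[mu]_(x in uballs s) ((maxs s av x `^ c - v `^ c) * h x)%:E +
   (v `^ c - t `^ c)%:E * \int[mu]_(x in U) (h x)%:E)%E.
  move=> c0 mh h0; rewrite -integralZ_EFin ?vtD//.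
  transitivity (\int[mu]_(x in U) ((maxs (b :: s) av x `^ c - v `^ c) * h x +
     (v `^ c - t `^ c) * h x)%:E)%E.
    by apply: eq_integral => x _; congr EFin; ring.
  rewrite (@integralD_EFin _ _ _ mu U
      (fun x => (maxs (b :: s) av x `^ c - v `^ c) * h x)
      (fun x => (v `^ c - t `^ c) * h x) mU).
  - rewrite (integral_support mu UsU); last first.
      by move=> x Ux nx; rewrite Mn// subrr mul0r.
    by rewrite (eq_integral (fun x => ((maxs s av x `^ c - v `^ c) * h x)%:E))// => x
      /set_mem Ux; rewrite Ms.
  - by apply: measurable_funM => //; apply: measurable_funB.
  - by apply: measurable_funM.
  - by move=> x Ux; rewrite mulr_ge0// powD.
  - by move=> x Ux; rewrite mulr_ge0// vtD.
rewrite (splitE q W q0 mW W0) (splitE _ _ qq mgW gW0).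
rewrite [in leRHS]ge0_muleDr; last 2 first.
- apply: integral_ge0 => x Ux; rewrite lee_fin mulr_ge0// -Ms// powD//.
  exact: UsU.
- by rewrite mule_ge0 ?lee_fin ?vtD// integral_ge0// => x _; rewrite lee_fin.
apply: leeD => //.
apply: (@le_trans _ _ ((q / (q - 1) * (v `^ (q - 1) - t `^ (q - 1)))%:E *
    (v%:E * wmeas mu W U))%E).
  rewrite muleA -EFinM; apply: lee_wpmul2r; first exact: wmeas_ge0.
  by rewrite lee_fin -(mulrA (q / (q - 1))) (mulrC _ v); exact: levelset_increment.
(* As [v] is the smallest level, every ball of [b :: s] meets the weak-type hypothesis at [v]. *)
have weak : (v%:E * wmeas mu W U <= D%:E * \int[mu]_(x in U) (g x * W x)%:E)%E.
  apply: weak_type_finite => // c cs; have [rc hc] := hs c cs => //.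
  apply: le_trans hc; apply: lee_wpmul2r; first exact: wmeas_ge0.
  by rewrite lee_fin; move: cs; rewrite inE => /orP[/eqP->//|]; exact: vs.
apply: (le_trans (lee_wpmul2l _ weak)).
  by rewrite lee_fin mulr_ge0// vtD.
by rewrite !muleA -!EFinM [in leRHS]mulrAC.
Qed.

Let K := q / (q - 1) * D.

(** [maxs_abel] at t = 0 bounds the left-hand side by K times the integral of M^(q-1) g W. Where M
    <= 2 K g, the integrand times K is at most K (2K)^(q-1) g^q; elsewhere it is at most M^q W / 2
    once weighted. The latter is absorbed on the left, whence the outer factor 2. *)
Lemma strong_type_finite s : avg_family s ->
  (\int[mu]_x (maxs s av x `^ q * W x)%:E <=
   (2 * (K * (2 * K) `^ (q - 1)))%:E * \int[mu]_x (g x `^ q * W x)%:E)%E.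
Proof.
move=> hs; pose s' := sort (relpre av <=%R) s.
have ss' : s =i s' by move=> b; rewrite mem_sort.
have sorts : sorted (relpre av <=%R) s'.
  by apply: sort_sorted => x y; exact: le_total.
have hs' : avg_family s' by move=> b; rewrite -ss'; exact: hs.
have K0 : 0 <= K by rewrite mulr_ge0.
set C := K * (2 * K) `^ (q - 1).
have C0 : 0 <= C by rewrite mulr_ge0// powR_ge0.
under eq_integral => x _ do rewrite (eq_mem_maxs _ _ ss').
set M := maxs s' av.
have mM : measurable_fun setT M by exact: measurable_maxs.
have M0 x : 0 <= M x by exact: maxs_ge0.
set X := (\int[mu]_x (M x `^ q * W x)%:E)%E.
have X0 : (0 <= X)%E by apply: integral_ge0 => x _; rewrite lee_fin mulr_ge0// powR_ge0.
have XU : X = (\int[mu]_(x in uballs s') (M x `^ q * W x)%:E)%E.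
  by apply: integral_support => // x _ nx; rewrite /M maxs_notin// powR0 ?mul0r// gt_eqF.
(* Absorption needs a finite left-hand side: M is at most the sum of all levels and is supported in
   finitely many balls. *)
have Xfin : (X < +oo)%E.
  pose A := \sum_(b <- s') av b.
  have A0 : 0 <= A by apply: sumr_ge0.
  have MA x : M x <= A.
    apply: maxs_le => // b bs _; rewrite /A (big_rem b)//= lerDl.
    exact: sumr_ge0.
  rewrite XU; apply: (@le_lt_trans _ _ (\int[mu]_(x in uballs s') (A `^ q * W x)%:E)%E).
    apply: le_integral_nonneg => x _; rewrite lee_fin; first by rewrite mulr_ge0// powR_ge0.
    by rewrite ler_wpM2r// ge0_ler_powR ?nnegrE// ltW.
  rewrite integralZ_EFin//; last 2 first.
  - exact: measurable_uballs.
  - exact: powR_ge0.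
  have fU : (wmeas mu W (uballs s') < +oo)%E.
    by apply: wmeas_uballs_fin => b /hs'[].
  by apply: lte_mul_pinfty; rewrite ?lee_fin ?powR_ge0.
have Xle : (X <= C%:E * \int[mu]_x (g x `^ q * W x)%:E + (2^-1)%:E * X)%E.
  have := @maxs_abel s' 0 (lexx 0) (fun b _ => av0 b) sorts hs'.
  rewrite !powR0 ?gt_eqF//; under eq_integral do rewrite subr0.
  under [X in (_ <= _ * X)%E]eq_integral do rewrite subr0.
  rewrite -/M -XU => /le_trans; apply.
  rewrite -integralZ_EFin//; first last.
  - by move=> x _; rewrite mulr_ge0// powR_ge0.
  - by apply: measurable_funM => //; exact: mpow.
  - exact: measurable_uballs.
  have mgq : measurable_fun setT (fun x => g x `^ q * W x) by measurability.
  have mMq : measurable_fun setT (fun x => M x `^ q * W x) by measurability.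
  rewrite -integralZ_EFin//; last by move=> x _; rewrite mulr_ge0// powR_ge0.
  rewrite -integralZ_EFin//; last by move=> x _; rewrite mulr_ge0// powR_ge0.
  rewrite -integralD_EFin//; first last.
  - by move=> x _; apply: mulr_ge0; [|exact: mulr_ge0 (powR_ge0 _ _) _].
  - by move=> x _; apply: mulr_ge0; [|exact: mulr_ge0 (powR_ge0 _ _) _].
  - by measurability.
  - by measurability.
  have lhs0 x : 0 <= q / (q - 1) * D * (M x `^ (q - 1) * (g x * W x)).
    by apply: (mulr_ge0 K0); apply: mulr_ge0 => //; exact: powR_ge0.
  apply: (@le_trans _ _ (\int[mu]_x
      (q / (q - 1) * D * (M x `^ (q - 1) * (g x * W x)))%:E)%E).
    apply: ge0_subset_integral => //.
    - exact: measurable_uballs.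
    - apply: measurable_EFin; apply: measurable_funM => //.
      by apply: measurable_funM => //; exact: mpow.
    - by move=> x _; rewrite lee_fin.
  apply: le_integral_nonneg => x _; rewrite lee_fin; first exact: lhs0.
  rewrite !mulrA -mulrDl ler_wpM2r//.
  have [Mg|gM] := leP (M x) (2 * K * g x).
    apply: (@le_trans _ _ (C * g x `^ q)); last by rewrite lerDl mulr_ge0// powR_ge0.
    apply: (@le_trans _ _ (K * (2 * K * g x) `^ (q - 1) * g x)).
      rewrite ler_wpM2r// ler_wpM2l// ge0_ler_powR ?nnegrE ?(ltW qq)//.
      by rewrite mulr_ge0// mulr_ge0.
    rewrite powRM//; last by rewrite mulr_ge0.
    by rewrite -[g x `^ q]mulr_powRB1// /C -!mulrA (mulrC (g x)).
  apply: (@le_trans _ _ (2^-1 * M x `^ q)); last by rewrite lerDr mulr_ge0// powR_ge0.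
  rewrite -/K -[M x `^ q]mulr_powRB1// (mulrAC K) (mulrA 2^-1) ler_wpM2r ?powR_ge0//.
  lra.
have Xn : X \is a fin_num by rewrite ge0_fin_numE.
move: Xle; set Y := (\int[mu]_x (g x `^ q * W x)%:E)%E.
have Y0 : (0 <= Y)%E by apply: integral_ge0 => x _; rewrite lee_fin mulr_ge0// powR_ge0.
have := mule_ge0 (C0 : (0 <= C%:E)%E) Y0.
rewrite (EFinM 2 C) -muleA -(fineK Xn).
case: (C%:E * Y)%E => [z _|_ _|//]; last by rewrite mulry gtr0_sg// mul1e leey.
rewrite -!EFinM -EFinD !lee_fin; lra.
Qed.

End StrongType.
End FiniteMaximal.

(** * Muckenhoupt weights *)

Section Weights.
Context {R : realType} {n : nat}.
Local Notation V := (n.-tuple R).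
Variable mu : {measure set V -> \bar R}.
Hypotheses (n_gt0 : (0 < n)%N) (mu_leb : is_lebesgue mu).
Implicit Types (w f : V -> R) (a x : V).

Let volE := volE mu_leb.
Let vol_gt0 := vol_gt0 n_gt0 mu_leb.

Lemma integral_oball_gt0 w a r : measurable_fun setT w -> (forall x, 0 <= w x) ->
  (\forall x \ae mu, 0 < w x) -> 0 < r -> (0 < wmeas mu w (oball a r))%E.
Proof.
move=> mw w0 wae r0; rewrite lt_neqAle wmeas_ge0// andbT eq_sym; apply/eqP => I0.
have mB := measurable_oball a r.
have wB : ae_eq mu (oball a r) (fun x => (w x)%:E) (cst 0%E).
  apply/ae_eq_integral_abs => //; first exact: measurable_EFin.
  by rewrite -[RHS]I0; apply: eq_integral => x _; rewrite gee0_abs// lee_fin.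
have notB : \forall x \ae mu, ~ oball a r x.
  move: wae wB; apply: filterS2 => x wx wB /wB/= [] wx0.
  by rewrite wx0 ltxx in wx.
have : mu (oball a r) = 0%E.
  apply/negligibleP => //; move: notB; rewrite /almost_everywhere.
  by apply: negligibleS => x /= Bx; apply.
by rewrite volE// => -[] /eqP; rewrite gt_eqF// vol_gt0.
Qed.

Definition wvol w a r : R := fine (wmeas mu w (oball a r)).

Definition locally_finite_weight w :=
  [/\ measurable_fun setT w, (forall x, 0 <= w x), (\forall x \ae mu, 0 < w x) &
      forall a r, 0 < r -> (wmeas mu w (oball a r) < +oo)%E].

Lemma wvolE w a r : locally_finite_weight w -> 0 < r ->
  wmeas mu w (oball a r) = (wvol w a r)%:E.
Proof.
case=> mw w0 wae wfin r0; rewrite /wvol fineK// ge0_fin_numE ?wmeas_ge0//.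
exact: wfin.
Qed.

Lemma wvol_gt0 w a r : locally_finite_weight w -> 0 < r -> 0 < wvol w a r.
Proof.
move=> lw r0; rewrite -lte_fin -wvolE//.
by case: lw => mw w0 wae _; exact: integral_oball_gt0.
Qed.

Lemma is_weight_locally_finite w : is_weight mu w -> locally_finite_weight w.
Proof.
case=> mw w0 wint wae; split=> // a r r0; have /integrableP[_] := wint a r.
by under eq_integral do rewrite gee0_abs ?lee_fin//.
Qed.

(* The testing form of the A_p condition: averages of f are controlled by
   weighted L^p averages. *)
Definition testing p C w := forall f, measurable_fun setT f -> (forall x, 0 <= f x) ->
  forall a r phi, 0 < r -> 0 < phi ->
  (\int[mu]_(x in oball a r) (f x `^ p * w x)%:E <=
     (phi `^ p * wvol w a r)%:E)%E ->
  (\int[mu]_(x in oball a r) (f x)%:E <= (C * phi * vol mu a r)%:E)%E.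

Lemma integral_indic_oball E a r : measurable E -> oball a r `<=` E -> 0 < r ->
  (\int[mu]_(x in E) (\1_(oball a r) x)%:E = (vol mu a r)%:E)%E.
Proof.
move=> mE sE r0; rewrite integral_indic//; last exact: measurable_oball.
by rewrite setIidl// volE.
Qed.

(** The indicator of B is tested on the dilated ball 3B: this gives |B| <= C phi |3B| <= C k phi
    |B|, hence 1 <= C k phi, and the p-th power is the claim. *)
Lemma testing_doubling p C w : 0 < p -> 0 <= C -> locally_finite_weight w ->
  testing p C w -> forall a r, 0 < r ->
  (wmeas mu w (oball a (3 * r)) <=
   ((C * (2 * n%:R * 3) ^+ n) `^ p)%:E * wmeas mu w (oball a r))%E.
Proof.
move=> p0 C0 lw tw a r r0; have r3 : 0 < 3 * r by rewrite mulr_gt0.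
have sB : oball a r `<=` oball a (3 * r).
  by apply: sub_oball; rewrite edistxx add0r; lra.
set k := (2 * n%:R * 3) ^+ n; have k0 : 0 <= k by rewrite exprn_ge0// !mulr_ge0.
rewrite !wvolE//; set W1 := wvol w a r; set W3 := wvol w a (3 * r).
have W10 : 0 < W1 by exact: wvol_gt0.
have W30 : 0 < W3 by exact: wvol_gt0.
(* This value makes the hypothesis of [testing] an equality. *)
pose phi := (W1 / W3) `^ p^-1.
have phi0 : 0 < phi by rewrite powR_gt0// divr_gt0.
have phip : phi `^ p = W1 / W3.
  by rewrite -powRrM mulVf ?gt_eqF// powRr1// ltW// divr_gt0.
have := tw (\1_(oball a r)) _ _ a (3 * r) phi r3 phi0.
have m1 : measurable_fun setT (\1_(oball a r) : V -> R).
  by apply: measurable_indic; exact: measurable_oball.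
move=> /(_ m1) /(_ _)/wrap[]; first by move=> x; rewrite indicE.
rewrite integral_indic_oball//; last exact: measurable_oball.
rewrite phip divfK ?gt_eqF// (integral_support mu sB); last first.
  move=> x _ nx; rewrite indicE memNset// powR0 ?mul0r// gt_eqF//.
rewrite (eq_integral (fun x => (w x)%:E)); last first.
  by move=> x xB; rewrite indicE xB powR1 mul1r.
rewrite -/(wmeas mu w _) wvolE// lexx => /(_ isT); rewrite lee_fin => h.
have {}h : vol mu a r <= C * phi * k * vol mu a r.
  apply: le_trans h _; rewrite -[leRHS]mulrA ler_wpM2l ?mulr_ge0 ?(ltW phi0)//.
  by apply: vol_dilation.
have {}h : 1 <= C * k * phi.
  by rewrite -(ler_pM2r (vol_gt0 a r0)) mul1r (mulrAC C).
have : 1 `^ p <= (C * k * phi) `^ p.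
  by rewrite ge0_ler_powR ?nnegrE ?(ltW p0)// (le_trans _ h).
rewrite powR1 powRM ?mulr_ge0 ?(ltW phi0)// phip -EFinM lee_fin => {}h.
by rewrite -[leLHS]mul1r -ler_pdivlMr// -mulrA.
Qed.

Lemma A1_testing w : A1 mu w -> exists2 C, 0 <= C & testing 1 C w.
Proof.
case=> iw [C hC]; have lw := is_weight_locally_finite iw.
exists (`|C| + 1) => [|f mf f0 a r phi r0 phi0 hf]; first by rewrite addr_ge0.
set v := vol mu a r; set W := wvol w a r in hf *.
have v0 : 0 < v by exact: vol_gt0.
have W0 : 0 < W by exact: wvol_gt0.
case: (lw) => mw w0 wae _; have mB := measurable_oball a r.
(* The essential supremum is an infimum of bounds; the constant |C| + 1 leaves the strict inequality
   from which an actual bound [y] of 1/w is extracted. Then f = (f w) (1/w) is integrated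
   directly. *)
have [y [hy yC]] : exists y : \bar R,
   (\forall x \ae mu, oball a r x -> ((w x)^-1%:E <= y)%E) /\
   (y < ((`|C| + 1) * v / W)%:E)%E.
  have /ereal_inf_lt[y hy yC] : (ess_sup_on mu (oball a r) (fun x => (w x)^-1%:E) <
      ((`|C| + 1) * v / W)%:E)%E; last by exists y.
  have := hC a r r0; rewrite /avg -/(wmeas mu w _) wvolE// volE//= -/v -/W -EFinM.
  have vW : 0 < v^-1 * W by rewrite mulr_gt0// invr_gt0.
  case: ess_sup_on => [z||//]; last by rewrite ltNyr.
    rewrite -EFinM lee_fin lte_fin => h.
    rewrite ltr_pdivlMr//; have {h} : v * (v^-1 * W * z) <= v * C by rewrite ler_pM2l.
    rewrite !mulrA divff ?gt_eqF// mul1r => h.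
    have := ler_norm C; rewrite mulrC [ltRHS]mulrC => hn.
    by apply: le_lt_trans h _; rewrite ltr_pM2l// (le_lt_trans hn)// ltrDl.
  by rewrite mulry gtr0_sg// mul1e leye_eq.
pose z := (`|C| + 1) * v / W.
have z0 : 0 <= z by rewrite divr_ge0// ?mulr_ge0// ?addr_ge0// ltW.
apply: (@le_trans _ _ (\int[mu]_(x in oball a r) (z * (f x `^ 1 * w x))%:E)%E).
  apply: ae_ge0_le_integral => //.
  - by move=> x _; rewrite lee_fin.
  - exact: measurable_EFin.
  - by move=> x _; rewrite lee_fin (mulr_ge0 z0)// mulr_ge0// powR_ge0.
  - by apply: measurable_EFin; measurability.
  - move: wae hy; apply: filterS2 => x wx hy Bx.
    have := le_lt_trans (hy Bx) yC; rewrite lte_fin -/z => hz.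
    rewrite lee_fin powRr1// mulrCA -[leLHS]mulr1 ler_wpM2l//.
    by rewrite -ler_pdivrMr// div1r ltW.
rewrite integralZ_EFin//; first last.
- by move=> x _; rewrite mulr_ge0// powR_ge0.
- by measurability.
apply: (le_trans (lee_wpmul2l _ hf)); first by rewrite lee_fin.
rewrite powRr1 ?(ltW phi0)// -EFinM lee_fin le_eqVlt; apply/orP; left.
by apply/eqP; rewrite /z; field; rewrite gt_eqF.
Qed.

(* [sg] is the dual weight w^(-1/(p-1)); the pair enters only through
   w = sg^(1-p), which is symmetric under p <-> p/(p-1). *)
Definition Ap_pair p C w sg := [/\ 1 < p, 0 <= C, locally_finite_weight w,
  locally_finite_weight sg & (forall x, w x = sg x `^ (1 - p)) /\
  forall a r, 0 < r ->
    wvol w a r / vol mu a r * (wvol sg a r / vol mu a r) `^ (p - 1) <= C].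

(* Where f <= kappa sg there is nothing to do, elsewhere
   f = f^p f^(1-p) <= f^p (kappa sg)^(1-p). *)
Lemma dual_weight_bound p (kappa s t : R) : 1 < p -> 0 < kappa -> 0 < s -> 0 <= t ->
  t <= kappa * s + kappa `^ (1 - p) * (t `^ p * s `^ (1 - p)).
Proof.
move=> p1 k0 s0 t0; have ks : 0 < kappa * s by rewrite mulr_gt0.
have [tk|kt] := leP t (kappa * s).
  by rewrite (le_trans tk)// lerDl !mulr_ge0// powR_ge0.
have t1 : 0 < t by rewrite (lt_trans ks).
rewrite -[leLHS]add0r lerD ?(ltW ks)//.
have -> : kappa `^ (1 - p) * (t `^ p * s `^ (1 - p)) =
    t `^ p * (kappa * s) `^ (1 - p).
  by rewrite powRM ?ltW//; ring.
have e : t `^ p * t `^ (1 - p) = t.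
  rewrite -powRD; last by rewrite (gt_eqF t1) implybT.
  by rewrite addrC subrK powRr1.
rewrite -[leLHS]e ler_wpM2l ?powR_ge0// -(opprB p 1) !powRN.
rewrite lef_pV2 ?posrE ?powR_gt0//.
by rewrite ge0_ler_powR ?nnegrE ?subr_ge0 ?(ltW p1) ?(ltW ks) ?(ltW t1)// ltW.
Qed.

(** Integrating [dual_weight_bound] takes the place of Hoelder's inequality. With kappa = phi |B| /
    sg(B) the first term is exactly phi |B| and the second at most the A_p product times phi |B|,
    whence C + 1. *)
Lemma Ap_pair_testing p C w sg : Ap_pair p C w sg -> testing p (C + 1) w.
Proof.
case=> p1 C0 lw ls [wsg hC] f mf f0 a r phi r0 phi0 hf.
have mB := measurable_oball a r.
set v := vol mu a r; set W := wvol w a r in hf *.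
set S := wvol sg a r; have S0 : 0 < S by exact: wvol_gt0.
have v0 : 0 < v by exact: vol_gt0.
have := hC a r r0; rewrite -/W -/S -/v => {}hC.
case: (lw) => mw w0 _ _; case: (ls) => ms s0 sae _.
pose kappa := phi * v / S; have k0 : 0 < kappa by rewrite divr_gt0// mulr_gt0.
apply: (@le_trans _ _ (\int[mu]_(x in oball a r)
    (kappa * sg x + kappa `^ (1 - p) * (f x `^ p * w x))%:E)%E).
  apply: ae_ge0_le_integral => //.
  - by move=> x _; rewrite lee_fin.
  - exact: measurable_EFin.
  - move=> x _; rewrite lee_fin; apply: addr_ge0; apply: mulr_ge0 => //.
    + exact: ltW.
    + exact: powR_ge0.
    + by apply: mulr_ge0 => //; exact: powR_ge0.
  - by apply: measurable_EFin; measurability.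
  - move: sae; apply: filterS => x sx _; rewrite lee_fin wsg.
    exact: dual_weight_bound.
have k0' := ltW k0.
have fw0 x : 0 <= f x `^ p * w x by rewrite mulr_ge0// powR_ge0.
have mfw : measurable_fun setT (fun x => f x `^ p * w x) by measurability.
rewrite (@integralD_EFin _ _ _ mu _ (fun x => kappa * sg x)
  (fun x => kappa `^ (1 - p) * (f x `^ p * w x)) mB); first last.
- by move=> x _; rewrite mulr_ge0// powR_ge0.
- by move=> x _; rewrite mulr_ge0.
- exact: measurable_funM.
- exact: measurable_funM.
rewrite (@integralZ_EFin _ _ _ mu _ sg kappa mB)//.
rewrite (@integralZ_EFin _ _ _ mu _ (fun x => f x `^ p * w x)
  (kappa `^ (1 - p)) mB)// ?powR_ge0//.
rewrite -/(wmeas mu sg _) wvolE// -/S.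
apply: (@le_trans _ _ ((kappa * S)%:E +
    (kappa `^ (1 - p))%:E * (phi `^ p * W)%:E)%E).
  by rewrite EFinM leeD2l// lee_wpmul2l// lee_fin powR_ge0.
rewrite -EFinM -EFinD lee_fin.
have -> : kappa * S = phi * v by rewrite /kappa divfK// gt_eqF.
have -> : kappa `^ (1 - p) * (phi `^ p * W) =
    (W / v * (S / v) `^ (p - 1)) * (phi * v).
  have -> : kappa = phi * (S / v)^-1 by rewrite /kappa invf_div mulrA.
  have : 0 < S / v by rewrite divr_gt0.
  move: (S / v) => sv sv0; rewrite powRM ?(ltW phi0)//; last by rewrite ltW// invr_gt0.
  have -> : sv^-1 `^ (1 - p) = sv `^ (p - 1).
    by rewrite -powR_inv1 ?(ltW sv0)// -powRrM mulN1r opprB.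
  have -> : phi `^ p = phi * phi `^ (p - 1).
    by rewrite mulr_powRB1 ?(ltW phi0)// (lt_trans _ p1).
  have -> : phi `^ (1 - p) = (phi `^ (p - 1))^-1 by rewrite -powRN opprB.
  have := powR_gt0 (p - 1) phi0; move: (phi `^ _) (sv `^ _) => P Q P0.
  by field; rewrite (gt_eqF P0) (gt_eqF v0).
apply: (@le_trans _ _ (phi * v + C * (phi * v))).
  by rewrite lerD2l ler_wpM2r// mulr_ge0// ltW.
rewrite le_eqVlt; apply/orP; left; apply/eqP; ring.
Qed.

(** With q = p/(p-1) one has q - 1 = 1/(p-1), so the power 1/(p-1) of the A_p product exchanges its
    factors; the relation between the weights inverts by (1-p)(1-q) = 1. *)
Lemma Ap_pair_dual p C w sg : Ap_pair p C w sg ->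
  Ap_pair (p / (p - 1)) (C `^ (p - 1)^-1) sg w.
Proof.
case=> p1 C0 lw ls [wsg hC]; have p0 : 0 < p by rewrite (lt_trans _ p1).
have pp : 0 < p - 1 by rewrite subr_gt0.
have e : p / (p - 1) - 1 = (p - 1)^-1 by field; rewrite gt_eqF.
split=> //; first by rewrite -subr_gt0 e invr_gt0.
  exact: powR_ge0.
split=> [x|a r r0].
  case: ls => _ s0 _ _.
  have e' : (1 - p) * (1 - p / (p - 1)) = 1 by field; rewrite gt_eqF.
  by rewrite wsg -powRrM e' powRr1.
rewrite e; have := hC a r r0; set u := wvol w a r / _; set s := wvol sg a r / _ => h.
have s0 : 0 <= s by rewrite divr_ge0// ltW ?vol_gt0// wvol_gt0.
have u0 : 0 <= u by rewrite divr_ge0// ltW ?vol_gt0// wvol_gt0.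
move: u s u0 s0 h => u s u0 s0 h.
have -> : s * u `^ (p - 1)^-1 = (u * s `^ (p - 1)) `^ (p - 1)^-1.
  by rewrite powRM ?powR_ge0// -powRrM divff ?gt_eqF// powRr1// mulrC.
rewrite ge0_ler_powR ?nnegrE ?invr_ge0 ?(ltW pp)//.
by rewrite mulr_ge0 ?powR_ge0.
Qed.

Lemma Ap_pairP p w : 1 < p -> Ap mu p w ->
  exists C, Ap_pair p C w (fun x => w x `^ (- (p - 1)^-1)).
Proof.
move=> p1 [iw [C hC]]; have lw := is_weight_locally_finite iw.
case: (lw) => mw w0 wae _; set sg := fun x => _.
have pp : 0 < p - 1 by rewrite subr_gt0.
have ms : measurable_fun setT sg.
  exact: (measurableT_comp (measurable_powR _)).
have s0 x : 0 <= sg x by exact: powR_ge0.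
have sae : \forall x \ae mu, 0 < sg x.
  by move: wae; apply: filterS => x wx; exact: powR_gt0.
(* An infinite sg(B) would make the A_p product infinite, its other factor being positive; the real
   bound [C] excludes this. *)
have ls : locally_finite_weight sg.
  split=> // a r r0; rewrite ltey; apply/eqP => Soo.
  have := hC a r r0; rewrite /avg -/(wmeas mu w _) -/(wmeas mu sg _) wvolE// Soo.
  rewrite volE//= mulry gtr0_sg ?invr_gt0 ?vol_gt0// mul1e poweRyr ?gt_eqF//.
  rewrite -EFinM mulry gtr0_sg ?mul1e ?leye_eq//.
  by rewrite mulr_gt0 ?invr_gt0 ?vol_gt0// wvol_gt0.
exists `|C|; split=> //; split=> [x|a r r0].
  rewrite /sg -powRrM -(opprB p 1) mulrNN mulVf ?gt_eqF// powRr1//.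
have := hC a r r0; rewrite /avg -/(wmeas mu w _) -/(wmeas mu sg _) !wvolE// volE//=.
rewrite -!EFinM lee_fin => h.
by rewrite (mulrC (wvol w a r)) (mulrC (wvol sg a r)) (le_trans h)// ler_norm.
Qed.

End Weights.

(** * Lerner's pointwise bound and Muckenhoupt's theorem for finite families *)

Section Lerner.
Context {R : realType} {n : nat}.
Local Notation V := (n.-tuple R).
Variable mu : {measure set V -> \bar R}.
Hypotheses (n_gt0 : (0 < n)%N) (mu_leb : is_lebesgue mu).
Implicit Types (w f g : V -> R) (s : seq (V * R)) (x : V).

Definition favg f (b : V * R) : R :=
  fine (\int[mu]_(x in oball b.1 b.2) (f x)%:E) / vol mu b.1 b.2.

Definition wavg w g (b : V * R) : R :=
  fine (\int[mu]_(x in oball b.1 b.2) (g x * w x)%:E) / wvol mu w b.1 b.2.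

Lemma favg_ge0 f b : (forall x, 0 <= f x) -> 0 <= favg f b.
Proof.
move=> f0; rewrite /favg divr_ge0// /vol fine_ge0//.
by apply: integral_ge0 => x _; rewrite lee_fin.
Qed.

Lemma wavg_ge0 w g b : (forall x, 0 <= w x) -> (forall x, 0 <= g x) ->
  0 <= wavg w g b.
Proof.
move=> w0 g0; rewrite /wavg divr_ge0// fine_ge0//.
  by apply: integral_ge0 => x _; rewrite lee_fin mulr_ge0.
exact: wmeas_ge0.
Qed.

Lemma wavgE w g b : locally_finite_weight mu w -> (forall x, 0 <= g x) ->
  0 < b.2 -> (\int[mu]_(x in oball b.1 b.2) (g x * w x)%:E < +oo)%E ->
  (wavg w g b * wvol mu w b.1 b.2)%:E =
  (\int[mu]_(x in oball b.1 b.2) (g x * w x)%:E)%E.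
Proof.
move=> lw g0 b0 fin; case: (lw) => _ w0 _ _.
rewrite /wavg divfK ?gt_eqF ?(wvol_gt0 n_gt0)// fineK// ge0_fin_numE//.
by apply: integral_ge0 => x _; rewrite lee_fin mulr_ge0.
Qed.

(** The inverse of 0 is 0, so dividing by a weight and multiplying back loses the value where the
    weight vanishes. For the weights at hand equality, [div_weightK], still holds almost
    everywhere. *)
Lemma div_weight_le (h v : R) : 0 <= h -> 0 <= v -> h * v `^ (-1) * v <= h.
Proof.
move=> h0 v0; rewrite powR_inv1//; have [->|vn] := eqVneq v 0.
  by rewrite mulr0.
by rewrite divfK.
Qed.

Lemma div_weightK (h v : R) : 0 < v -> h * v `^ (-1) * v = h.
Proof. by move=> v0; rewrite powR_inv1 ?(ltW v0)// divfK// gt_eqF. Qed.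

(** Since each of the two weights is a power of the other, this moves integrals between them. At v =
    0 both sides vanish, because 0 to a nonzero power is 0. *)
Lemma div_weight_powR (q h v : R) : 1 < q -> 0 <= h -> 0 <= v ->
  (h * v `^ (-1)) `^ q * v = h `^ q * v `^ (1 - q).
Proof.
move=> q1 h0 v0; rewrite powRM ?powR_ge0// -mulrA; congr (_ * _).
have [->|vn] := eqVneq v 0.
  by rewrite mulr0 powR0// subr_eq0 lt_eqF.
rewrite -powRrM mulN1r -[X in _ * X]powRr1// -powRD ?vn ?implybT//.
by rewrite addrC.
Qed.

Lemma strong_type_wavg p C w : 1 < p -> 0 <= C -> locally_finite_weight mu w ->
  (forall a r, 0 < r ->
    (wmeas mu w (oball a (3 * r)) <= C%:E * wmeas mu w (oball a r))%E) ->
  exists2 K, 0 <= K & forall g s, measurable_fun setT g -> (forall x, 0 <= g x) ->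
    (forall b, b \in s -> 0 < b.2 /\
      (\int[mu]_(x in oball b.1 b.2) (g x * w x)%:E < +oo)%E) ->
    (\int[mu]_x (maxs s (wavg w g) x `^ p * w x)%:E <=
     K%:E * \int[mu]_x (g x `^ p * w x)%:E)%E.
Proof.
move=> p1 C0 lw dw; have p0 : 0 < p by rewrite (lt_trans _ p1).
pose K := p / (p - 1) * C.
have K0 : 0 <= K by rewrite mulr_ge0// divr_ge0// ?subr_ge0 ltW.
exists (2 * (K * (2 * K) `^ (p - 1))).
  by rewrite mulr_ge0// mulr_ge0// powR_ge0.
move=> g s mg g0 hs; case: (lw) => mw w0 wae wfin.
apply: strong_type_finite => //; first by move=> b; exact: wavg_ge0.
move=> b bs; have [b0 bfin] := hs b bs; split=> //.
by rewrite wvolE// -EFinM wavgE.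
Qed.

(** On a ball B of the family the average of f is (sg(B)/|B|) bv(B), with bv the sg-average of f/sg.
    As M1 >= bv(B) on B, the w-average of M1^(p-1)/w over B is at least bv(B)^(p-1) |B|/w(B), while
    A_p bounds (sg(B)/|B|)^(p-1) by C |B|/w(B). Hence the average of f to the power p-1 is at most C
    M2. *)
Lemma lerner_finite p C w sg : Ap_pair mu p C w sg ->
  exists2 K, 0 <= K & forall f s, measurable_fun setT f -> (forall x, 0 <= f x) ->
    (forall b, b \in s -> 0 < b.2 /\
      (\int[mu]_(x in oball b.1 b.2) (f x)%:E < +oo)%E) ->
    (\int[mu]_x (maxs s (favg f) x `^ p * w x)%:E <=
     K%:E * \int[mu]_x (f x `^ p * w x)%:E)%E.
Proof.
move=> apw; have aps := Ap_pair_dual n_gt0 mu_leb apw.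
case: (apw) => p1 C0 lw ls [wsg hC]; case: (aps) => q1 C'0 _ _ [sgw _].
have p0 : 0 < p by rewrite (lt_trans _ p1).
have pp : 0 < p - 1 by rewrite subr_gt0.
set q := p / (p - 1) in q1 aps sgw; have q0 : 0 < q by rewrite (lt_trans _ q1).
have tw := Ap_pair_testing n_gt0 mu_leb apw.
have ts := Ap_pair_testing n_gt0 mu_leb aps.
have dw := testing_doubling n_gt0 mu_leb p0 (addr_ge0 C0 ler01) lw tw.
have ds := testing_doubling n_gt0 mu_leb q0 (addr_ge0 C'0 ler01) ls ts.
have [K1 K10 st1] := strong_type_wavg p1 (powR_ge0 _ _) ls ds.
have [K2 K20 st2] := strong_type_wavg q1 (powR_ge0 _ _) lw dw.
case: (lw) => mw w0 wae wfin; case: (ls) => ms s0 sae sfin.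
exists (C `^ q * (K2 * K1)); first by rewrite mulr_ge0 ?powR_ge0// mulr_ge0.
move=> f s mf f0 hs.
pose g1 x := f x * sg x `^ (-1).
have mg1 : measurable_fun setT g1 by measurability.
have g10 x : 0 <= g1 x by rewrite mulr_ge0// powR_ge0.
have int1 (b : V * R) : (\int[mu]_(x in oball b.1 b.2) (g1 x * sg x)%:E <=
    \int[mu]_(x in oball b.1 b.2) (f x)%:E)%E.
  by apply: le_integral_nonneg => x _; rewrite lee_fin; [exact: mulr_ge0|exact: div_weight_le].
have hs1 b : b \in s -> 0 < b.2 /\
    (\int[mu]_(x in oball b.1 b.2) (g1 x * sg x)%:E < +oo)%E.
  by move=> /hs[b0 bfin]; split=> //; exact: le_lt_trans bfin.
pose bv := wavg sg g1; pose M1 := maxs s bv.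
have bv0 b : 0 <= bv b by exact: wavg_ge0.
have mM1 : measurable_fun setT M1 by exact: measurable_maxs.
have M10 x : 0 <= M1 x by exact: maxs_ge0.
pose h x := M1 x `^ (p - 1); have h0 x : 0 <= h x by exact: powR_ge0.
have mh : measurable_fun setT h by exact: (measurableT_comp (measurable_powR _)).
pose g2 x := h x * w x `^ (-1).
have mg2 : measurable_fun setT g2 by measurability.
have g20 x : 0 <= g2 x by rewrite mulr_ge0// powR_ge0.
(* [wavg] goes through [fine], so the integrals must be finite; finiteness of the family bounds M1
   and thereby g2 w. *)
have hs2 b : b \in s -> 0 < b.2 /\
    (\int[mu]_(x in oball b.1 b.2) (g2 x * w x)%:E < +oo)%E.
  move=> /hs[b0 bfin]; split=> //; pose A := \sum_(c <- s) bv c.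
  have A0 : 0 <= A by apply: sumr_ge0.
  have MA x : M1 x <= A.
    apply: maxs_le => // c cs _; rewrite /A (big_rem c)//= lerDl.
    exact: sumr_ge0.
  apply: (@le_lt_trans _ _ (\int[mu]_(x in oball b.1 b.2) (A `^ (p - 1))%:E)%E).
    apply: le_integral_nonneg => x _; rewrite lee_fin; first exact: mulr_ge0.
    apply: (le_trans (div_weight_le (h0 x) (w0 x))).
    by rewrite /h ge0_ler_powR ?nnegrE ?(ltW pp).
  by rewrite integral_cst ?(volE mu_leb) -?EFinM ?ltry//; exact: measurable_oball.
pose dv := wavg w g2; pose M2 := maxs s dv.
have dv0 b : 0 <= dv b by exact: wavg_ge0.
have M20 x : 0 <= M2 x by exact: maxs_ge0.
have mM2 : measurable_fun setT M2 by exact: measurable_maxs.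
have key x : maxs s (favg f) x <= (C * M2 x) `^ (p - 1)^-1.
  apply: maxs_le => [|[c r] bs bx]; first exact: powR_ge0.
  have [/= r0 bfin] := hs _ bs; have [_ bfin1] := hs1 _ bs; have [_ bfin2] := hs2 _ bs.
  have mB := measurable_oball c r.
  set v := vol mu c r; have v0 : 0 < v by exact: vol_gt0.
  set W := wvol mu w c r; have W0 : 0 < W by exact: wvol_gt0.
  set S := wvol mu sg c r; have S0 : 0 < S by exact: wvol_gt0.
  have e1 : favg f (c, r) * v <= bv (c, r) * S.
    rewrite /favg divfK ?gt_eqF// -lee_fin fineK; last first.
      by rewrite ge0_fin_numE// integral_ge0// => y _; rewrite lee_fin.
    rewrite /bv wavgE//=; apply: ae_ge0_le_integral => //.
    - by move=> y _; rewrite lee_fin.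
    - exact: measurable_EFin.
    - by move=> y _; rewrite lee_fin; exact: mulr_ge0.
    - by apply: measurable_EFin; exact: measurable_funM.
    - by move: sae; apply: filterS => y sy _; rewrite lee_fin /g1 div_weightK.
  have e2 : bv (c, r) `^ (p - 1) * v <= dv (c, r) * W.
    rewrite -lee_fin /dv wavgE//= EFinM -(volE mu_leb)// -integral_cst//.
    apply: ae_ge0_le_integral => //.
    - by move=> y _; rewrite lee_fin powR_ge0.
    - by move=> y _; rewrite lee_fin; exact: mulr_ge0.
    - by apply: measurable_EFin; exact: measurable_funM.
    - move: wae; apply: filterS => y wy yB; rewrite lee_fin /g2 div_weightK//.
      rewrite /h ge0_ler_powR ?nnegrE ?(ltW pp)//.
      exact: (@le_maxs _ _ _ _ (c, r)).
  have := hC c r r0; rewrite -/W -/S -/v => {}hC.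
  apply: (@le_trans _ _ (S / v * bv (c, r))).
    by rewrite mulrAC ler_pdivlMr// [leRHS]mulrC.
  have Sv0 : 0 <= S / v by rewrite divr_ge0// ltW.
  have -> : S / v * bv (c, r) = ((S / v * bv (c, r)) `^ (p - 1)) `^ (p - 1)^-1.
    by rewrite -powRrM divff ?gt_eqF// powRr1// mulr_ge0.
  rewrite ge0_ler_powR ?nnegrE ?invr_ge0 ?(ltW pp) ?powR_ge0// ?mulr_ge0//.
  apply: (@le_trans _ _ (C * dv (c, r))).
    rewrite powRM//; apply: (@le_trans _ _ (C * (bv (c, r) `^ (p - 1) * v / W))).
      rewrite mulrA mulrA -[leRHS]mulrA [leRHS]mulrAC ler_wpM2r ?powR_ge0//.
      move: (_ `^ _) hC => Q hC.
      have -> : Q = (W / v * Q) * (v / W) by field; rewrite (gt_eqF v0) (gt_eqF W0).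
      by rewrite ler_wpM2r// divr_ge0 ?(ltW v0) ?(ltW W0).
    by rewrite ler_wpM2l// ler_pdivrMr.
  by rewrite ler_wpM2l//; exact: le_maxs.
have {key}step1 : (\int[mu]_x (maxs s (favg f) x `^ p * w x)%:E <=
    (C `^ q)%:E * \int[mu]_x (M2 x `^ q * w x)%:E)%E.
  rewrite -integralZ_EFin ?powR_ge0//; first last.
  - by move=> x _; rewrite mulr_ge0// powR_ge0.
  - apply: measurable_funM; last exact: mw.
    exact: (measurableT_comp (measurable_powR _) mM2).
  apply: le_integral_nonneg => x _; rewrite lee_fin.
    by rewrite mulr_ge0// powR_ge0.
  rewrite mulrA ler_wpM2r// -powRM//.
  have -> : q = (p - 1)^-1 * p by rewrite /q mulrC.
  rewrite powRrM ge0_ler_powR ?nnegrE ?(ltW p0) ?powR_ge0 ?maxs_ge0//.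
(* By (p-1) q = p and w^(1-q) = sg, the integrand g2^q w equals M1^p sg. In the next step sg^(1-p) =
   w likewise turns g1^p sg into f^p w. *)
have step2 : (\int[mu]_x (M2 x `^ q * w x)%:E <=
    K2%:E * \int[mu]_x (M1 x `^ p * sg x)%:E)%E.
  have := st2 g2 s mg2 g20 hs2 => /le_trans; apply.
  rewrite lee_wpmul2l ?lee_fin// le_eqVlt; apply/orP; left; apply/eqP.
  apply: eq_integral => x _; congr EFin.
  rewrite /g2 div_weight_powR// -sgw /h -powRrM.
  by have -> : (p - 1) * q = p by rewrite /q; field; rewrite gt_eqF.
have step3 : (\int[mu]_x (M1 x `^ p * sg x)%:E <=
    K1%:E * \int[mu]_x (f x `^ p * w x)%:E)%E.
  have := st1 g1 s mg1 g10 hs1 => /le_trans; apply.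
  rewrite lee_wpmul2l ?lee_fin// le_eqVlt; apply/orP; left; apply/eqP.
  by apply: eq_integral => x _; rewrite /g1 div_weight_powR// -wsg.
rewrite EFinM EFinM -muleA -muleA.
apply: (le_trans step1); rewrite lee_wpmul2l ?lee_fin ?powR_ge0//.
by apply: (le_trans step2); rewrite lee_wpmul2l ?lee_fin.
Qed.

End Lerner.

(** * The local estimates *)

Section LocalMaximal.
Context {R : realType} {n : nat}.
Local Notation V := (n.-tuple R).
Variable mu : {measure set V -> \bar R}.
Hypotheses (n_gt0 : (0 < n)%N) (mu_leb : is_lebesgue mu).
Implicit Types (a x : V) (m N : nat).

Let volE := volE mu_leb.
Let vol_gt0 := vol_gt0 n_gt0 mu_leb.

Definition rball m : V * R :=
  if unpickle m is Some (c, rho) then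
    ([tuple ratr (tnth (c : n.-tuple rat) i) | i < n],
     if 0 < ratr rho :> R then ratr (rho : rat) else 1)
  else ([tuple 0 | i < n], 1).

Definition rfamily N : seq (V * R) := [seq rball m | m <- iota 0 N].

Lemma rball_gt0 m : 0 < (rball m).2.
Proof. by rewrite /rball; case: unpickle => [[c rho]|] //=; case: ifPn. Qed.

Lemma rfamily_gt0 N b : b \in rfamily N -> 0 < b.2.
Proof. by move=> /mapP[m _ ->]; exact: rball_gt0. Qed.

Lemma mem_rfamily N m : (m < N)%N -> rball m \in rfamily N.
Proof. by move=> mN; apply: map_f; rewrite mem_iota. Qed.

Lemma sub_rfamily N M : (N <= M)%N -> {subset rfamily N <= rfamily M}.
Proof.
move=> NM b /mapP[m]; rewrite mem_iota/= add0n => mN ->.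
by rewrite mem_rfamily// (leq_trans mN).
Qed.

Lemma rball_approx x s : 0 < s -> exists m,
  oball x s `<=` oball (rball m).1 (rball m).2 /\ (rball m).2 <= 2 * s.
Proof.
move=> s0; have [rho] : exists q : rat, ratr q \in `]s, 2 * s[.
  by apply: rat_in_itvoo; lra.
rewrite in_itv/= => /andP[srho rho2].
(* A centre within [e] of x in each coordinate is at distance at most n e = rho - s, so its ball of
   radius rho contains B(x, s). *)
pose e := (ratr rho - s) / n%:R.
have nr0 : 0 < n%:R :> R by rewrite ltr0n.
have e0 : 0 < e by rewrite divr_gt0// subr_gt0.
have /fin_all_exists[c hc] (i : 'I_n) : exists q : rat,
    ratr q \in `](tnth x i - e), (tnth x i + e)[.
  by apply: rat_in_itvoo; lra.
exists (pickle ([tuple c i | i < n], rho)); rewrite /rball pickleK.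
have -> : 0 < ratr rho :> R by rewrite (lt_trans s0).
split => /=; last exact: ltW.
apply: sub_oball; apply: (@le_trans _ _ (n%:R * e + s)); last first.
  by rewrite /e mulrC divfK ?gt_eqF// subrK.
rewrite lerD2r; apply: edist_le_bound; first exact: ltW.
move=> i; rewrite !tnth_mktuple; have := hc i; rewrite in_itv/= => /andP[h1 h2].
by rewrite ler_norml; apply/andP; split; lra.
Qed.

Variables (p C : R) (w : V -> R).
Hypotheses (p1 : 1 <= p) (C1 : 1 <= C).
Hypotheses (lw : locally_finite_weight mu w) (tw : testing mu p C w).

Let p0 : 0 < p. Proof. by rewrite (lt_le_trans _ p1). Qed.
Let C0 : 0 < C. Proof. by rewrite (lt_le_trans _ C1). Qed.

(** [kap] is the constant of [vol_dilation] for the factor 2, and [D] below that of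
    [testing_doubling]. *)
Let kap : R := (2 * n%:R * 2) ^+ n.
Let D : R := (C * (2 * n%:R * 3) ^+ n) `^ p.

Let kap0 : 0 < kap.
Proof. by rewrite exprn_gt0// !mulr_gt0// ltr0n. Qed.

Let D0 : 0 <= D. Proof. exact: powR_ge0. Qed.

Let dw a r : 0 < r ->
  (wmeas mu w (oball a (3 * r)) <= D%:E * wmeas mu w (oball a r))%E.
Proof. exact: (testing_doubling n_gt0 mu_leb p0 (ltW C0) lw tw). Qed.

Variables (f : V -> R) (a : V) (r phi : R).
Hypotheses (mf : measurable_fun setT f) (r0 : 0 < r) (phi0 : 0 < phi).
Hypothesis f_phi : forall t, r < t ->
  (\int[mu]_(x in oball a t) (`|f x| `^ p * w x)%:E <=
   (phi `^ p * wvol mu w a t)%:E)%E.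

Let absf (x : V) : R := `|f x|.

Let mabsf : measurable_fun setT absf.
Proof. exact: (measurableT_comp (@normr_measurable R setT)). Qed.

(** The factor 3 is the one for which doubling of w is proved; moreover 3 r > r, as [f_phi]
    demands. *)
Definition near_part x := absf x * \1_(oball a (3 * r)) x.

Let mnear : measurable_fun setT near_part.
Proof.
apply: measurable_funM => //; apply: measurable_indic; exact: measurable_oball.
Qed.

Let near0 x : 0 <= near_part x.
Proof. by apply: mulr_ge0; [exact: normr_ge0|rewrite indicE]. Qed.

Let r3 : 0 < 3 * r. Proof. by rewrite mulr_gt0. Qed.

Let rr3 : r < 3 * r. Proof. by rewrite ltr_pMl// ltr1n. Qed.

Let int_absf t : r < t ->
  (\int[mu]_(x in oball a t) (absf x)%:E <= (C * phi * vol mu a t)%:E)%E.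
Proof.
move=> rt; apply: tw => //; first by move=> x; exact: normr_ge0.
  by rewrite (lt_trans r0).
exact: f_phi.
Qed.

Let int_near E : measurable E ->
  (\int[mu]_(x in E) (near_part x)%:E <= (C * phi * vol mu a (3 * r))%:E)%E.
Proof.
move=> mE; apply: le_trans (int_absf rr3).
rewrite [leLHS]integral_mkcond [leRHS]integral_mkcond.
apply: le_integral_nonneg => x _; rewrite !patchE.
  by case: ifPn => _; rewrite ?lee_fin.
rewrite /near_part indicE; case: (x \in oball a _); case: (x \in E) => //=;
  by rewrite ?mulr1 ?mulr0 ?lee_fin// normr_ge0.
Qed.

Let near_fin b : (\int[mu]_(x in oball b.1 b.2) (near_part x)%:E < +oo)%E.
Proof. exact: le_lt_trans (int_near (measurable_oball _ _)) (ltry _). Qed.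

Let near_w : (\int[mu]_x (near_part x `^ p * w x)%:E <=
  (phi `^ p * D * wvol mu w a r)%:E)%E.
Proof.
rewrite (@integral_support _ _ _ mu setT (oball a (3 * r)))//; last first.
  by move=> x _ nx; rewrite /near_part indicE memNset// mulr0 powR0 ?mul0r// gt_eqF.
rewrite (eq_integral (fun x => (`|f x| `^ p * w x)%:E)); last first.
  by move=> x xB; rewrite /near_part indicE xB mulr1.
apply: (le_trans (f_phi rr3)).
rewrite lee_fin -mulrA ler_wpM2l ?powR_ge0//.
by rewrite -lee_fin EFinM -!wvolE//; exact: dw.
Qed.

Let av := favg mu near_part.

Let av0 b : 0 <= av b. Proof. exact: (favg_ge0 mu b near0). Qed.

(* Balls of radius at most [r] stay in [B(a, 2r)]; larger ones are comparable
   to balls centred at [a]. *)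
Lemma avg_near_far x s : oball a r x -> 0 < s ->
  (avg mu (oball x s) (fun y => `|f y|%:E) <= (kap * C * phi)%:E)%E \/
  exists2 m, oball (rball m).1 (rball m).2 x &
    (avg mu (oball x s) (fun y => `|f y|%:E) <= (kap * av (rball m))%:E)%E.
Proof.
move=> ax s0; have v0 : 0 < vol mu x s by exact: vol_gt0.
have mB := measurable_oball x s.
have le_avg (z : R) : (\int[mu]_(y in oball x s) `|f y|%:E <= (z * vol mu x s)%:E)%E ->
    (avg mu (oball x s) (fun y => `|f y|%:E) <= z%:E)%E.
  move=> h; rewrite /avg.
  apply: (@le_trans _ _ ((fine (mu (oball x s)))^-1%:E * (z * vol mu x s)%:E)%E).
    by rewrite lee_wpmul2l// lee_fin invr_ge0 fine_ge0.
  by rewrite -EFinM lee_fin -/(vol mu x s) mulrC mulfK// gt_eqF.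
rewrite /oball/= in ax; have [sr|rs] := leP s r; [right|left].
  have [m [sub m2]] := rball_approx x s0.
  exists m; first by apply: sub; exact: oball_center.
  apply: le_avg.
  have sub3 : oball x s `<=` oball a (3 * r) by apply: sub_oball; lra.
  rewrite (eq_integral (fun y => (near_part y)%:E)); last first.
    by move=> y /set_mem/sub3 yB; rewrite /near_part indicE mem_set// mulr1.
  apply: (@le_trans _ _
      (\int[mu]_(y in oball (rball m).1 (rball m).2) (near_part y)%:E)%E).
    apply: ge0_subset_integral => //; first exact: measurable_oball.
      exact: measurable_EFin.
    by move=> y _; rewrite lee_fin.
  have b0 := rball_gt0 m.
  have -> : (\int[mu]_(y in oball (rball m).1 (rball m).2) (near_part y)%:E =
      (av (rball m) * vol mu (rball m).1 (rball m).2)%:E)%E.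
    rewrite /av /favg divfK ?gt_eqF ?vol_gt0// fineK// ge0_fin_numE//.
    by apply: integral_ge0 => y _; rewrite lee_fin.
  rewrite lee_fin [leRHS](_ : _ = av (rball m) * (kap * vol mu x s)); last by ring.
  rewrite ler_wpM2l//.
  have q0 : 0 < (rball m).2 / s by rewrite divr_gt0.
  have := vol_dilation n_gt0 mu_leb x (rball m).1 s0 q0.
  rewrite divfK ?gt_eqF// => /le_trans; apply.
  rewrite ler_wpM2r ?(ltW v0)//; apply: lerXn2r; rewrite ?nnegrE.
  - by apply: mulr_ge0; [rewrite mulr_ge0|exact: ltW].
  - by rewrite !mulr_ge0.
  - by rewrite ler_wpM2l ?mulr_ge0// ler_pdivrMr.
apply: le_avg; have s2 : 0 < 2 * s by rewrite mulr_gt0.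
apply: (@le_trans _ _ (\int[mu]_(y in oball a (2 * s)) (absf y)%:E)%E).
  apply: ge0_subset_integral => //; first exact: measurable_oball.
  - exact: measurable_EFin.
  - by apply: sub_oball; lra.
have rs2 : r < 2 * s by lra.
apply: (le_trans (int_absf rs2)).
rewrite lee_fin [leRHS](_ : _ = C * phi * (kap * vol mu x s)); last by ring.
by rewrite ler_wpM2l ?mulr_ge0 ?(ltW C0) ?(ltW phi0)//; exact: vol_dilation.
Qed.

Lemma maxf_ge0 x : (0 <= maxf mu f x)%E.
Proof.
apply: (@le_trans _ _ (avg mu (oball x 1) (fun y => `|f y|%:E))).
  rewrite /avg mule_ge0 ?lee_fin ?invr_ge0 ?fine_ge0//.
  by apply: integral_ge0 => y _; rewrite lee_fin.
by apply: ereal_sup_ubound; exists 1 => //=; rewrite in_itv/= ltr01.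
Qed.

Lemma maxf_le x (z : \bar R) : (forall s, 0 < s ->
  (avg mu (oball x s) (fun y => `|f y|%:E) <= z)%E) -> (maxf mu f x <= z)%E.
Proof.
move=> h; apply: ge_ereal_sup => _ [s /= s0 <-].
by apply: h; rewrite in_itv/= andbT in s0.
Qed.

Section Strong.
Variable CL : R.
Hypotheses (CL0 : 0 <= CL).
Hypothesis lerner : forall (g : V -> R) (s : seq (V * R)),
  measurable_fun setT g -> (forall x, 0 <= g x) ->
  (forall b, b \in s -> 0 < b.2 /\
    (\int[mu]_(x in oball b.1 b.2) (g x)%:E < +oo)%E) ->
  (\int[mu]_x (maxs s (favg mu g) x `^ p * w x)%:E <=
   CL%:E * \int[mu]_x (g x `^ p * w x)%:E)%E.

(** The functions g N increase to a measurable majorant of (Mf)^p w. Their two summands answer to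
    the two alternatives of [avg_near_far] and yield the two summands of the constant; [D] comes
    from returning from B(a, 3r) to B(a, r). *)
Lemma maxf_strong_local :
  (\int[mu]_(x in oball a r) (poweR `|maxf mu f x| p * (w x)%:E) <=
   ((kap `^ p * CL * D + (kap * C) `^ p) * (phi `^ p * wvol mu w a r))%:E)%E.
Proof.
case: (lw) => mw w0 wae wfin; have mB := measurable_oball a r.
pose M N := maxs (rfamily N) av; pose L := kap * C * phi.
have L0 : 0 <= L by rewrite !mulr_ge0 ?ltW.
have mM N : measurable_fun setT (M N) by exact: measurable_maxs.
have M0 N x : 0 <= M N x by exact: maxs_ge0.
pose g N x := kap `^ p * (M N x `^ p * w x) + L `^ p * w x.
have g0 N x : 0 <= g N x.
  by apply: addr_ge0; rewrite mulr_ge0 ?powR_ge0// mulr_ge0 ?powR_ge0.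
have mMw N : measurable_fun setT (fun x => M N x `^ p * w x).
  apply: measurable_funM => //; exact: (measurableT_comp (measurable_powR _)).
have mg N : measurable_fun setT (g N).
  by apply: measurable_funD; apply: measurable_funM.
have gmono x : {homo (fun N => (g N x)%:E) : N N' / (N <= N')%N >-> (N <= N')%E}.
  move=> N N' NN'; rewrite lee_fin lerD2r ler_wpM2l ?powR_ge0// ler_wpM2r//.
  rewrite ge0_ler_powR ?nnegrE ?(ltW p0)// maxs_le// => b bs bx.
  by apply: le_maxs => //; exact: sub_rfamily bs.
have gle x N : ((g N x)%:E <= limn (fun N => (g N x)%:E))%E.
  apply: lime_ge; first exact: ereal_nondecreasing_is_cvgn (gmono x).
  by exists N => // N' /= NN'; exact: gmono.
have pointwise x : oball a r x ->
    (poweR `|maxf mu f x| p * (w x)%:E <= limn (fun N => (g N x)%:E))%E.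
  move=> ax; have := gle x; move: (limn _) => l gl.
  have l0 : (0 <= l)%E by apply: le_trans (gl 0%N); rewrite lee_fin.
  have [w00|wn] := eqVneq (w x) 0; first by rewrite w00 mule0.
  have wx : 0 < w x by rewrite lt_def wn w0.
  case: l l0 gl => [z z0 gl|_ _|//]; last by rewrite leey.
  rewrite lee_fin in z0.
  have zw0 : 0 <= z / w x by rewrite divr_ge0// ltW.
  (* Here [z] is the limit of the g N x. It is enough that each average is at most some y with y^p
     w(x) <= z, and a single g N x provides this. *)
  suff h : (maxf mu f x <= ((z / w x) `^ p^-1)%:E)%E.
    rewrite gee0_abs ?maxf_ge0//.
    apply: (@le_trans _ _ (poweR ((z / w x) `^ p^-1)%:E p * (w x)%:E)%E).
      rewrite lee_wpmul2r ?lee_fin// gt0_ler_poweR ?(ltW p0) ?in_itv/= ?leey ?andbT//.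
        exact: maxf_ge0.
      by rewrite lee_fin powR_ge0.
    by rewrite poweR_EFin -powRrM mulVf ?gt_eqF// powRr1// -EFinM divfK ?gt_eqF.
  have root y : 0 <= y -> y `^ p * w x <= z -> y <= (z / w x) `^ p^-1.
    move=> y0 hy; have -> : y = (y `^ p) `^ p^-1.
      by rewrite -powRrM divff ?gt_eqF// powRr1.
    by rewrite ge0_ler_powR ?nnegrE ?powR_ge0 ?invr_ge0 ?(ltW p0)// ler_pdivlMr.
  apply: maxf_le => s s0; have [far|[m bx near]] := avg_near_far ax s0.
    apply: (le_trans far); rewrite lee_fin; apply: root => //.
    have := gl 0%N; rewrite lee_fin; apply: le_trans.
    by rewrite /g lerDr mulr_ge0 ?powR_ge0// mulr_ge0 ?powR_ge0.
  apply: (le_trans near); rewrite lee_fin; apply: root.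
    by rewrite mulr_ge0// ltW.
  have := gl m.+1; rewrite lee_fin; apply: le_trans.
  apply: (@le_trans _ _ (kap `^ p * (M m.+1 x `^ p * w x))); last first.
    by rewrite /g lerDl mulr_ge0 ?powR_ge0.
  rewrite powRM ?(ltW kap0)// -mulrA ler_wpM2l ?powR_ge0// ler_wpM2r//.
  rewrite ge0_ler_powR ?nnegrE ?(ltW p0)//.
  by apply: le_maxs => //; exact: mem_rfamily.
apply: (@le_trans _ _ (\int[mu]_(x in oball a r) limn (fun N => (g N x)%:E))%E).
  apply: le_integral_nonneg => // x _.
  by rewrite mule_ge0 ?poweR_ge0// lee_fin.
rewrite monotone_convergence//; last 2 first.
- by move=> N; exact: measurable_EFin.
- by move=> N x _; rewrite lee_fin.
apply: lime_le.
  apply: ereal_nondecreasing_is_cvgn => N N' NN'.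
  apply: le_integral_nonneg => x _; first by rewrite lee_fin.
  exact: gmono.
apply: nearW => N.
rewrite (@integralD_EFin _ _ _ mu _ (fun x => kap `^ p * (M N x `^ p * w x))
  (fun x => L `^ p * w x) mB); first last.
- by move=> x _; rewrite mulr_ge0 ?powR_ge0.
- by move=> x _; rewrite mulr_ge0 ?powR_ge0// mulr_ge0 ?powR_ge0.
- exact: measurable_funM.
- exact: measurable_funM.
rewrite (@integralZ_EFin _ _ _ mu _ (fun x => M N x `^ p * w x) (kap `^ p) mB)
  ?powR_ge0//; last by move=> x _; rewrite mulr_ge0 ?powR_ge0.
rewrite (@integralZ_EFin _ _ _ mu _ w (L `^ p) mB) ?powR_ge0//.
rewrite -/(wmeas mu w _) wvolE//.
have hs b : b \in rfamily N -> 0 < b.2 /\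
    (\int[mu]_(x in oball b.1 b.2) (near_part x)%:E < +oo)%E.
  by move=> /rfamily_gt0 b0; split.
have h : (\int[mu]_(x in oball a r) (M N x `^ p * w x)%:E <=
    (CL * (phi `^ p * D * wvol mu w a r))%:E)%E.
  apply: (@le_trans _ _ (\int[mu]_x (M N x `^ p * w x)%:E)%E).
    apply: ge0_subset_integral => //; first exact: measurable_EFin.
    by move=> x _; rewrite lee_fin mulr_ge0 ?powR_ge0.
  apply: (le_trans (lerner mnear near0 hs)).
  by rewrite EFinM lee_wpmul2l ?lee_fin.
apply: (@le_trans _ _ ((kap `^ p)%:E * (CL * (phi `^ p * D * wvol mu w a r))%:E +
    (L `^ p)%:E * (wvol mu w a r)%:E)%E).
  by rewrite leeD2r// lee_wpmul2l// lee_fin powR_ge0.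
rewrite -!EFinM -EFinD lee_fin {1}/L powRM ?(ltW phi0) ?mulr_ge0 ?(ltW kap0) ?(ltW C0)//.
by rewrite le_eqVlt; apply/orP; left; apply/eqP; ring.
Qed.

End Strong.

(** Meant for the level sets of [maxf mu f], to which [le_wmeas] does not apply for want of
    measurability. *)
Lemma le_wmeas_sub E F : E `<=` F -> (wmeas mu w E <= wmeas mu w F)%E.
Proof.
case: (lw) => _ w0 _ _ EF; rewrite /wmeas integral_mkcond [leRHS]integral_mkcond.
apply: le_integral_nonneg => x _; rewrite !patchE.
  by case: ifPn => _; rewrite ?lee_fin.
case: ifPn => [/set_mem/EF xF|_]; first by rewrite mem_set.
by case: ifPn => _; rewrite ?lee_fin.
Qed.

Section Weak.
Hypothesis p_eq1 : p = 1.

(** For gam <= kap C phi the trivial bound by w(B(a, r)) is enough. Above that, averages over large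
    balls stay below gam, so each point of the level set lies in a rational ball with kap av > gam,
    and the weak-type bound applies to finite unions of such balls. One factor [D] is Vitali's, the
    other comes from w(B(a, 3r)). *)
Lemma maxf_weak_local gam : 0 < gam ->
  (gam%:E * wmeas mu w [set x | oball a r x /\ (gam%:E < `|maxf mu f x|)%E] <=
   ((kap * C * D * D + kap * C) * (phi * wvol mu w a r))%:E)%E.
Proof.
move=> gam0; case: (lw) => mw w0 wae wfin; have mB := measurable_oball a r.
have W0 : 0 <= wvol mu w a r by rewrite ltW// wvol_gt0.
have c0 : 0 <= kap * C * D * D by rewrite !mulr_ge0// ltW.
have c1 : 0 <= kap * C by rewrite mulr_ge0// ltW.
set E := [set x | _].
have [gs|gl] := leP gam (kap * C * phi).
  apply: (@le_trans _ _ (gam%:E * (wvol mu w a r)%:E)%E).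
    rewrite lee_wpmul2l ?lee_fin ?(ltW gam0)// -wvolE//.
    by apply: le_wmeas_sub => x [].
  rewrite -EFinM lee_fin mulrA ler_wpM2r//; apply: (le_trans gs).
  by rewrite ler_wpM2r ?(ltW phi0)// lerDr.
pose sel N := [seq b <- rfamily N | gam < kap * av b].
pose G N := uballs (sel N).
have mG N : measurable (G N) by exact: measurable_uballs.
have Gmono : nondecreasing_seq G.
  move=> N N' NN'; apply/subsetPset => x /uballsP[b]; rewrite mem_filter => /andP[h bs] bx.
  by apply/uballsP; exists b => //; rewrite mem_filter h (sub_rfamily NN').
have EG : E `<=` \bigcup_N G N.
  move=> x [ax hx]; have [//|nG] := pselect ((\bigcup_N G N) x).
  exfalso; move: hx; rewrite gee0_abs ?maxf_ge0// ltNge => /negP; apply.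
  apply: maxf_le => s s0; have [far|[m bx near]] := avg_near_far ax s0.
    by apply: (le_trans far); rewrite lee_fin ltW.
  apply: (le_trans near); rewrite lee_fin leNgt; apply/negP => h; apply: nG.
  exists m.+1 => //; apply/uballsP; exists (rball m) => //.
  by rewrite mem_filter h mem_rfamily.
(* [testing] at phi = lam, read contrapositively: a Lebesgue average above gam / kap = C lam forces
   a w-average of at least lam. *)
pose lam := gam / (kap * C).
have kC0 : 0 < kap * C by rewrite mulr_gt0.
have lam0 : 0 < lam by rewrite divr_gt0.
have GN N : (lam%:E * wmeas mu w (G N) <= (D * (phi * D * wvol mu w a r))%:E)%E.
  apply: (@le_trans _ _ (D%:E * \int[mu]_(x in G N) (near_part x * w x)%:E)%E).
    apply: (weak_type_finite mw w0 D0 dw mnear near0 (ltW lam0)).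
    - by move=> b; rewrite mem_filter => /andP[_ /rfamily_gt0].
    - move=> b; rewrite mem_filter => /andP[hb /rfamily_gt0 b0].
      rewrite leNgt; apply/negP => hlt.
      have vb0 : 0 < vol mu b.1 b.2 by exact: vol_gt0.
      have := tw mnear near0 b0 lam0 (a := b.1).
      rewrite p_eq1 powRr1 ?(ltW lam0)// EFinM -wvolE// => tb.
      have {tb} : (\int[mu]_(x in oball b.1 b.2) (near_part x)%:E <=
          (C * lam * vol mu b.1 b.2)%:E)%E.
        apply: tb; apply: le_trans (ltW hlt).
        by under eq_integral do rewrite powRr1//.
      apply/negP; rewrite -ltNge.
      have -> : (\int[mu]_(x in oball b.1 b.2) (near_part x)%:E =
          (av b * vol mu b.1 b.2)%:E)%E.
        rewrite /av /favg divfK ?gt_eqF// fineK// ge0_fin_numE//.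
        by apply: integral_ge0 => y _; rewrite lee_fin.
      rewrite lte_fin ltr_pM2r//.
      have -> : C * lam = gam / kap by rewrite /lam; field; rewrite !gt_eqF.
      by rewrite ltr_pdivrMr// mulrC.
  rewrite EFinM lee_wpmul2l ?lee_fin//.
  apply: (@le_trans _ _ (\int[mu]_x (near_part x `^ p * w x)%:E)%E); last first.
    by apply: (le_trans near_w); rewrite p_eq1 powRr1 ?(ltW phi0).
  apply: (@le_trans _ _ (\int[mu]_x (near_part x * w x)%:E)%E).
    apply: ge0_subset_integral => //; last by move=> x _; rewrite lee_fin mulr_ge0.
    by apply: measurable_EFin; exact: measurable_funM.
  apply: le_integral_nonneg => x _; first by rewrite lee_fin mulr_ge0.
  by rewrite p_eq1 powRr1.
have cv : wmeas mu w (G N) @[N --> \oo] --> wmeas mu w (\bigcup_N G N).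
  apply: ge0_nondecreasing_set_cvg_integral => //.
  - by move=> N; exact: measurable_EFin.
  - by move=> N x _; rewrite lee_fin.
have UG : (wmeas mu w (\bigcup_N G N) <= (D * (phi * D * wvol mu w a r) / lam)%:E)%E.
  rewrite -(cvg_lim _ cv)//; apply: lime_le.
    by apply/cvg_ex; eexists; exact: cv.
  apply: nearW => N; have := GN N.
  have : wmeas mu w (G N) \is a fin_num.
    rewrite ge0_fin_numE ?wmeas_ge0//; apply: wmeas_uballs_fin => // b.
    by rewrite mem_filter => /andP[_ /rfamily_gt0].
  case: (wmeas mu w (G N)) => // y _.
  by rewrite -EFinM !lee_fin => h; rewrite ler_pdivlMr// mulrC.
apply: (@le_trans _ _ (gam%:E * (D * (phi * D * wvol mu w a r) / lam)%:E)%E).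
  rewrite lee_wpmul2l ?lee_fin ?(ltW gam0)//; apply: le_trans UG.
  exact: le_wmeas_sub.
rewrite -EFinM lee_fin.
have -> : gam * (D * (phi * D * wvol mu w a r) / lam) =
    kap * C * D * D * (phi * wvol mu w a r).
  by rewrite /lam; field; rewrite !gt_eqF.
by rewrite ler_wpM2r ?mulr_ge0 ?(ltW phi0)// lerDl.
Qed.

End Weak.
End LocalMaximal.

(** * From real bounds of the supremum to the theorem *)

Section Assembly.
Context {R : realType} {n : nat}.
Local Notation V := (n.-tuple R).
Variable mu : {measure set V -> \bar R}.
Hypotheses (n_gt0 : (0 < n)%N) (mu_leb : is_lebesgue mu).

Lemma testing_weaken p C C' (w : V -> R) : C <= C' -> testing mu p C w -> testing mu p C' w.
Proof.
move=> CC tw f mf f0 a r phi r0 phi0 hf; apply: (le_trans (tw _ mf f0 _ _ _ r0 phi0 hf)).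
by rewrite lee_fin -!mulrA ler_wpM2r// mulr_ge0 ?(ltW phi0)// fine_ge0.
Qed.

Variables (p : R) (w f : V -> R) (a : V) (r : R).
Hypotheses (p0 : 0 < p) (lw : locally_finite_weight mu w) (r0 : 0 < r).
Hypothesis f_loc : Lpw_loc mu p w f.

Let S : \bar R := ereal_sup [set (poweR (wmeas mu w (oball a t)) (- p^-1) *
  Lpw_norm mu p w (oball a t) (fun x => (f x)%:E))%E | t in `]r, +oo[].

Lemma Lpw_norm_EFin t : Lpw_norm mu p w (oball a t) (fun x => (f x)%:E) =
  poweR (\int[mu]_(x in oball a t) (`|f x| `^ p * w x)%:E)%E p^-1.
Proof. by rewrite /Lpw_norm; congr poweR; apply: eq_integral. Qed.

Lemma sup_ge0 : (0 <= S)%E.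
Proof.
apply: (@le_trans _ _ (poweR (wmeas mu w (oball a (r + 1))) (- p^-1) *
    Lpw_norm mu p w (oball a (r + 1)) (fun x => (f x)%:E))%E).
  by rewrite mule_ge0 ?poweR_ge0.
by apply: ereal_sup_ubound; exists (r + 1); rewrite //= in_itv/= andbT ltrDl.
Qed.

(** Clearing the negative power of w(B(a, t)) and the root turns a bound on the supremum into the
    hypothesis [f_phi] of the local estimates. *)
Lemma integral_le_sup phi t : 0 < phi -> (S <= phi%:E)%E -> r < t ->
  (\int[mu]_(x in oball a t) (`|f x| `^ p * w x)%:E <=
   (phi `^ p * wvol mu w a t)%:E)%E.
Proof.
move=> phi0 Sphi rt; have t0 : 0 < t by rewrite (lt_trans r0).
have W0 : 0 < wvol mu w a t by exact: wvol_gt0.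
have : (poweR (wmeas mu w (oball a t)) (- p^-1) *
    Lpw_norm mu p w (oball a t) (fun x => (f x)%:E) <= phi%:E)%E.
  apply: le_trans Sphi; apply: ereal_sup_ubound; exists t => //=.
  by rewrite in_itv/= rt.
have pn : p^-1 != 0 by rewrite invr_neq0// gt_eqF.
have := f_loc.2 a t; rewrite Lpw_norm_EFin => /(lty_poweRy pn).
have : (0 <= \int[mu]_(x in oball a t) (`|f x| `^ p * w x)%:E)%E.
  case: lw => _ w0 _ _; apply: integral_ge0 => x _.
  by rewrite lee_fin mulr_ge0// powR_ge0.
rewrite wvolE//; case: (\int[mu]_(x in _) _)%E => [F|//|//].
rewrite lee_fin => F0 _; rewrite !poweR_EFin -EFinM !lee_fin => h.
have {h} : F `^ p^-1 <= phi * wvol mu w a t `^ p^-1.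
  by rewrite -ler_pdivrMr ?powR_gt0// mulrC -powRN.
move=> h; have : (F `^ p^-1) `^ p <= (phi * wvol mu w a t `^ p^-1) `^ p.
  by rewrite ge0_ler_powR ?nnegrE ?powR_ge0 ?(ltW p0)// mulr_ge0 ?powR_ge0// ltW.
by rewrite powRM ?powR_ge0 ?(ltW phi0)// -!powRrM mulVf ?gt_eqF// !powRr1// ltW.
Qed.

(* It suffices to test against the reals [phi] exceeding the supremum, which
   also covers the cases of a zero or infinite supremum. *)
Lemma le_mul_sup (X : \bar R) (K : R) : 0 < K ->
  (forall phi, 0 < phi -> (S <= phi%:E)%E -> (X <= (K * phi)%:E)%E) ->
  (X <= K%:E * S)%E.
Proof.
move=> K0 h; have := sup_ge0; case: S h => [s h s0|_ _|//]; last first.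
  by rewrite mulry gtr0_sg// mul1e leey.
rewrite lee_fin in s0; apply/lee_addgt0Pr => e e0.
have d0 : 0 < e / K by rewrite divr_gt0.
apply: (le_trans (h (s + e / K) _ _)).
- by rewrite ltr_wpDl.
- by rewrite lee_fin lerDl ltW.
- by rewrite -EFinM -EFinD lee_fin mulrDr mulrCA divff ?gt_eqF// mulr1.
Qed.

End Assembly.

Unset Implicit Arguments.

Theorem theorem3p1 (R : realType) (n : nat) (n_gt0 : (0 < n)%N)
    (mu : {measure set (n.-tuple R) -> \bar R}) (mu_leb : is_lebesgue mu)
    (p : R) (p_ge1 : 1 <= p) (w : n.-tuple R -> R)
    (w_Ap : if p == 1 then A1 mu w else Ap mu p w) :
  exists C1 C2 : R, 0 < C1 /\ 0 < C2 /\
  forall (a : n.-tuple R) (r : R), 0 < r ->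
    (1 < p -> forall f : n.-tuple R -> R, Lpw_loc mu p w f ->
      (Lpw_norm mu p w (oball a r) (maxf mu f) <=
       C1%:E * poweR (wmeas mu w (oball a r)) p^-1 *
       ereal_sup [set poweR (wmeas mu w (oball a t)) (- p^-1) *
                      Lpw_norm mu p w (oball a t) (fun x => (f x)%:E)
                 | t in `]r, +oo[])%E) /\
    (p = 1 -> forall f : n.-tuple R -> R, Lpw_loc mu 1 w f ->
      (WLpw_norm mu 1 w (oball a r) (maxf mu f) <=
       C2%:E * wmeas mu w (oball a r) *
       ereal_sup [set poweR (wmeas mu w (oball a t)) (-1) *
                      Lpw_norm mu 1 w (oball a t) (fun x => (f x)%:E)
                 | t in `]r, +oo[])%E).
Proof.
have p0 : 0 < p by rewrite (lt_le_trans _ p_ge1).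
have [pe1|pn1] := eqVneq p 1; move: w_Ap.
- rewrite pe1 eqxx => wA1; have lw := is_weight_locally_finite wA1.1.
  have [C C0 tw] := A1_testing n_gt0 mu_leb wA1.
  have C1 : 1 <= C + 1 by rewrite lerDr.
  have {}tw : testing mu 1 (C + 1) w by apply: testing_weaken tw; rewrite lerDl.
  set D := ((C + 1) * (2 * n%:R * 3) ^+ n) `^ (1 : R).
  set kap : R := (2 * n%:R * 2) ^+ n.
  have kC0 : 0 < kap * (C + 1).
    by rewrite mulr_gt0 ?(lt_le_trans _ C1)// exprn_gt0// !mulr_gt0// ltr0n.
  pose K := kap * (C + 1) * D * D + kap * (C + 1).
  have K0 : 0 < K.
    apply: ltr_wpDl => //; apply: mulr_ge0; last exact: powR_ge0.
    by apply: mulr_ge0; [exact: ltW|exact: powR_ge0].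
  (* As p is fixed, the other estimate is vacuous and its constant is set to 1. *)
  exists 1, K; split=> //; split=> // a r r0; split; first by rewrite ltxx.
  move=> _ f floc; have W0 : 0 < wvol mu w a r by exact: wvol_gt0.
  rewrite wvolE// -EFinM.
  have := @le_mul_sup _ _ mu 1 w f a r _ (K * wvol mu w a r); rewrite invr1.
  apply; first by rewrite mulr_gt0.
  move=> phi phi0 Sphi; apply: ge_ereal_sup => _ [gam /= gam0 <-].
  rewrite in_itv/= andbT in gam0; rewrite invr1 poweRe1 ?wmeas_ge0//; last by case: lw.
  have f_phi t : r < t -> (\int[mu]_(x in oball a t) (`|f x| `^ 1 * w x)%:E <=
      (phi `^ 1 * wvol mu w a t)%:E)%E.
    by apply: integral_le_sup => //; rewrite invr1.
  have := maxf_weak_local n_gt0 mu_leb (lexx 1) C1 lw tw floc.1 r0 phi0 f_phi erefl gam0.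
  move=> /le_trans; apply; rewrite lee_fin le_eqVlt; apply/orP; left; apply/eqP.
  by rewrite -/kap -/D -/K (mulrC phi) mulrA.
- rewrite (negPf pn1) => wAp; have p1 : 1 < p by rewrite lt_def pn1.
  have [C apw] := Ap_pairP n_gt0 mu_leb p1 wAp.
  have lw : locally_finite_weight mu w by case: apw.
  have C0 : 0 <= C by case: apw.
  have tw := Ap_pair_testing n_gt0 mu_leb apw.
  have C1 : 1 <= C + 1 by rewrite lerDr.
  have [CL CL0 lerner] := lerner_finite n_gt0 mu_leb apw.
  set D := ((C + 1) * (2 * n%:R * 3) ^+ n) `^ p.
  set kap : R := (2 * n%:R * 2) ^+ n.
  have kC0 : 0 < kap * (C + 1).
    by rewrite mulr_gt0 ?(lt_le_trans _ C1)// exprn_gt0// !mulr_gt0// ltr0n.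
  pose K := kap `^ p * CL * D + (kap * (C + 1)) `^ p.
  have K0 : 0 < K.
    by rewrite ltr_wpDl ?powR_gt0// !mulr_ge0 ?powR_ge0.
  exists (K `^ p^-1), 1; split; first exact: powR_gt0.
  split=> // a r r0; split; last by move=> pe1; rewrite pe1 eqxx in pn1.
  move=> _ f floc; have W0 : 0 < wvol mu w a r by exact: wvol_gt0.
  rewrite wvolE// poweR_EFin -EFinM; apply: le_mul_sup.
    by rewrite mulr_gt0 ?powR_gt0.
  move=> phi phi0 Sphi.
  have f_phi t : r < t -> (\int[mu]_(x in oball a t) (`|f x| `^ p * w x)%:E <=
      (phi `^ p * wvol mu w a t)%:E)%E by exact: integral_le_sup.
  have h := maxf_strong_local n_gt0 mu_leb p_ge1 C1 lw tw floc.1 r0 phi0 f_phi CL0 lerner.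
  (* The right-hand side is the p-th root of the bound in [h], so monotonicity of the root
     concludes. *)
  have -> : (K `^ p^-1 * wvol mu w a r `^ p^-1 * phi)%:E =
      poweR (K * (phi `^ p * wvol mu w a r))%:E p^-1.
    rewrite poweR_EFin; congr EFin.
    rewrite powRM ?(ltW K0) ?mulr_ge0 ?powR_ge0 ?(ltW W0)//.
    rewrite powRM ?powR_ge0 ?(ltW W0)// -powRrM divff ?gt_eqF// powRr1 ?(ltW phi0)//.
    by rewrite mulrAC mulrA.
  rewrite /Lpw_norm gt0_ler_poweR ?invr_ge0 ?(ltW p0)// ?in_itv/= ?leey ?andbT.
  - case: lw => _ w0 _ _; apply: integral_ge0 => x _.
    by rewrite mule_ge0 ?poweR_ge0// lee_fin.
  - by rewrite lee_fin mulr_ge0 ?(ltW K0)// mulr_ge0 ?powR_ge0// ltW.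
Qed.
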